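(* Let $k$ be a field and let $(V,c)$ be a finite dimensional braided vector space over $k$ that is left triangular with respect to some totally ordered basis $X$ of $V$. Identify the tensor algebra $T(V)$ with the free algebra $k\langle X\rangle$, let $I\subsetneq k\langle X\rangle$ be a braided biideal and let $\pi:k\langle X\rangle\to k\langle X\rangle/I$ be the quotient map. Then $\pi(B_I)$ and $\pi([B_I]_c)$ are bases of the vector space $k\langle X\rangle/I$. These are the (truncated) PBW bases generated by $\pi(S_I)$, respectively by $\pi([S_I]_c)$, with heights $h_I(u)$ for $u\in S_I$.
   Context: **Braidings.** A braided vector space $(V,c)$ is a vector space $V$ with an automorphism $c$ of $V\otimes V$ satisfying the braid equation $(c\otimes \mathrm{id})(\mathrm{id}\otimes c)(c\otimes \mathrm{id})=(\mathrm{id}\otimes c)(c\otimes \mathrm{id})(\mathrm{id}\otimes c)$. For an endomorphism $r$ of $V\otimes V$ define $r_{n,m}:V^{\otimes n}\otimes V^{\otimes m}\to V^{\otimes m}\otimes V^{\otimes n}$ by: identities if $n=0$ or $m=0$, $r_{1,1}=r$, $r_{1,m+1}=(\mathrm{id}_V\otimes r_{1,m})(r\otimes \mathrm{id}_{V^{\otimes m}})$, $r_{n+1,m}=(r_{n,m}\otimes \mathrm{id}_V)(\mathrm{id}_{V^{\otimes n}}\otimes r_{1,m})$. For $r=c$ these give a braiding on $T(V)$, again denoted $c$. $T(V)\underline{\otimes}T(V)$ is $T(V)\otimes T(V)$ with multiplication $(m\otimes m)(\mathrm{id}\otimes c\otimes \mathrm{id})$, where $m$ is the multiplication of $T(V)$.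 $T(V)$ is a braided bialgebra with $\Delta:T(V)\to T(V)\underline{\otimes}T(V)$ and $\varepsilon:T(V)\to k$ the algebra morphisms with $\Delta(v)=1\otimes v+v\otimes 1$, $\varepsilon(v)=0$ for $v\in V$. A braided biideal $I$ of $R=T(V)$ is an ideal and coideal (i.e. $\Delta(I)\subset I\otimes R+R\otimes I$, $\varepsilon(I)=0$) with $c(R\otimes I+I\otimes R)=R\otimes I+I\otimes R$. **Left triangular.** For $V$ finite dimensional with totally ordered basis $X$, $c\in\mathrm{End}(V\otimes V)$ is left triangular with respect to $X$ if there are $\gamma_{x,y}\in k$ ($x,y\in X$) and $v_{x,y,z}\in V$ ($x,y,z\in X$, $z>y$) such that for all $x,y\in X$: $c(x\otimes y)=\gamma_{x,y}\,y\otimes x+\sum_{z>y} z\otimes v_{x,y,z}$. **Words.** $\langle X\rangle$ is the free monoid (words in $X$), $k\langle X\rangle$ the free algebra $=T(V)$, $l(u)$ the length of $u$. Lexicographical order: $u<v$ iff $u$ is a proper beginning of $v$, or $u=ras$, $v=rbt$ with $r,s,t\in\langle X\rangle$, $a,b\in X$, $a<b$. A word $u\neq1$ is a Lyndon word if $u<w$ for every factorization $u=vw$ with $v,w\ne 1$. Every word is uniquely a product $l_1\cdots l_r$ of Lyndon words with $l_1\ge\dots\ge l_r$ (Lyndon decomposition). The Shirshov decomposition of a Lyndon word $u$ with $l(u)>1$ is $u=vw$ where $w$ is the longest proper ending of $u$ that is Lyndon ($v$ is then Lyndon too). Standard order: $u\succeq v$ iff $l(u)<l(v)$, or $l(u)=l(v)$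 and $u\ge v$ lexicographically; $\langle X\rangle_{\succ u}=\{w: w\succ u\}$. **Commutators.** For $r\in\mathrm{End}(V\otimes V)$ satisfying the braid equation, the linear map $[-]_r:k\langle X\rangle\to k\langle X\rangle$ is defined on words by $[1]_r=1$, $[x]_r=x$ for $x\in X$, $[u]_r=m(\mathrm{id}-r_{l(v),l(w)})([v]_r\otimes[w]_r)$ for $u$ Lyndon with Shirshov decomposition $u=vw$, and $[u]_r=[u_1]_r\cdots[u_t]_r$ for a word with Lyndon decomposition $u=u_1\cdots u_t$. For $U\subset\langle X\rangle$, $[U]_r=\{[u]_r:u\in U\}$. **PBW data.** For a totally ordered subset $(S,<)$ of an algebra and a height function $h:S\to\mathbb N\cup\{\infty\}$, the PBW set generated by $(S,<)$ and $h$ is the set of all products $s_1^{e_1}\cdots s_t^{e_t}$ with $t\ge0$, $s_1>\dots>s_t$ in $S$, $0<e_i<h(s_i)$. Put $S_I=\{u\in\langle X\rangle: u \text{ Lyndon}, u\notin k\langle X\rangle_{\succ u}+I\}$; for $u\in S_I$, $h_I(u)=\min\{t\in\mathbb N: u^t\in k\langle X\rangle_{\succ u^t}+I\}\in\{2,3,\dots,\infty\}$ ($\infty$ if there is no such $t$). $B_I$ is the PBW set in $k\langle X\rangle$ generated by $S_I$ with the lexicographical order and $h_I$. The sets $\pi(S_I)$, $\pi([S_I]_c)$ carry the order and heights transported from $S_I$. *)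

(* Defs.v *)
From HB Require Import structures.
From mathcomp Require Import all_boot all_order all_algebra finmap.
From mathcomp.multinomials Require Import monalg.
From mathcomp Require Import boolp classical_sets.

Set Implicit Arguments.
Unset Strict Implicit.
Unset Printing Implicit Defensive.

Import Order.TTheory GRing.Theory.

Local Open Scope classical_set_scope.
Local Open Scope quotient_scope.
Local Open Scope ring_scope.

Section ProperIdeals.

(* Two-sided ideals; in an algebra they are automatically subspaces, since
   a *: x = (a *: 1) * x. *)
Record properIdeal (R : nzRingType) := ProperIdeal {
  ideal_set :> set R;
  ideal_set0 : ideal_set 0;
  ideal_setD : forall x y, ideal_set x -> ideal_set y -> ideal_set (x + y);
  ideal_setMl : forall a x, ideal_set x -> ideal_set (a * x);
  ideal_setMr : forall a x, ideal_set x -> ideal_set (x * a);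
  ideal_proper : ideal_set <> setT
}.

Definition ideal_pred (R : nzRingType) (I : properIdeal R) : R -> bool :=
  fun x => `[< ideal_set I x >].

Section Closed.
Variables (R : nzRingType) (I : properIdeal R).

Lemma ideal_pred_zmod_closed : zmod_closed (ideal_pred I).
Proof.
split; first by apply/asboolP; exact: ideal_set0.
move=> x y /asboolP Ix /asboolP Iy; apply/asboolP.
by apply: ideal_setD => //; rewrite -mulN1r; apply: ideal_setMl.
Qed.

HB.instance Definition _ :=
  GRing.isZmodClosed.Build R (ideal_pred I) ideal_pred_zmod_closed.

Definition ideal_zmod : zmodClosed R :=
  GRing.ZmodClosed.clone R (ideal_pred I) _.

Lemma ideal_pred1 : 1 \notin ideal_pred I.
Proof.
apply/negP => /asboolP I1; apply: (@ideal_proper _ I); apply/seteqP; split => // x _.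
by rewrite -[x]mulr1; apply: ideal_setMl.
Qed.

Lemma ideal_predMl a x : x \in ideal_pred I -> a * x \in ideal_pred I.
Proof. by move=> /asboolP Ix; apply/asboolP; exact: ideal_setMl. Qed.

Lemma ideal_predMr a x : x \in ideal_pred I -> x * a \in ideal_pred I.
Proof. by move=> /asboolP Ix; apply/asboolP; exact: ideal_setMr. Qed.

End Closed.
End ProperIdeals.

(* MathComp has the quotient of a zmodType by an additive subgroup, but ring
   quotients only in the commutative case. *)
Definition quotient (R : nzRingType) (I : properIdeal R) : Type :=
  Quotient.quot (ideal_zmod I).

Section QuotientRing.
Variables (R : nzRingType) (I : properIdeal R).

HB.instance Definition _ := GRing.Zmodule.on (quotient I).

Definition quotient_map : R -> quotient I :=
  \pi_(Quotient.quot (ideal_zmod I)).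

Definition quotient_repr : quotient I -> R :=
  @repr _ (Quotient.quot (ideal_zmod I)).

Local Notation pi := quotient_map.
Local Notation rep := quotient_repr.

Lemma quotient_reprK : cancel rep pi.
Proof. exact: (@reprK _ (Quotient.quot (ideal_zmod I))). Qed.

Lemma quotient_map_eq x y : (pi x == pi y) = (x - y \in ideal_pred I).
Proof. by rewrite (Quotient.idealrBE (ideal_zmod I)). Qed.

Lemma quotient_repr_map x : x - rep (pi x) \in ideal_pred I.
Proof. by rewrite -quotient_map_eq quotient_reprK. Qed.

Lemma quotient_map_zmod : zmod_morphism pi.
Proof. exact: (@pi_is_zmod_morphism _ _ _ (Quotient.quot (ideal_zmod I))). Qed.

HB.instance Definition _ :=
  GRing.isZmodMorphism.Build R (quotient I) pi quotient_map_zmod.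

Definition qone : quotient I := pi 1.
Definition qmul (x y : quotient I) : quotient I := pi (rep x * rep y).

Lemma pi_qmul x y : pi (x * y) = qmul (pi x) (pi y).
Proof.
apply/eqP; rewrite quotient_map_eq.
set x' := rep _; set y' := rep _.
have -> : x * y - x' * y' = (x - x') * y + x' * (y - y').
  by rewrite mulrBl mulrBr addrA subrK.
apply: (@rpredD _ (ideal_zmod I)).
  by apply: ideal_predMr; exact: quotient_repr_map.
by apply: ideal_predMl; exact: quotient_repr_map.
Qed.

Lemma qmulA : associative qmul.
Proof.
move=> x y z.
rewrite -[x]quotient_reprK -[y]quotient_reprK -[z]quotient_reprK.
by rewrite -!pi_qmul mulrA.
Qed.

Lemma qmul1 : left_id qone qmul.
Proof. by move=> x; rewrite -[x]quotient_reprK -pi_qmul mul1r. Qed.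

Lemma qmulr1 : right_id qone qmul.
Proof. by move=> x; rewrite -[x]quotient_reprK -pi_qmul mulr1. Qed.

Lemma qmulDl : left_distributive qmul +%R.
Proof.
move=> x y z.
rewrite -[x]quotient_reprK -[y]quotient_reprK -[z]quotient_reprK.
by rewrite -raddfD -!pi_qmul -raddfD mulrDl.
Qed.

Lemma qmulDr : right_distributive qmul +%R.
Proof.
move=> x y z.
rewrite -[x]quotient_reprK -[y]quotient_reprK -[z]quotient_reprK.
by rewrite -raddfD -!pi_qmul -raddfD mulrDr.
Qed.

Lemma qone_neq0 : qone != 0.
Proof. by rewrite -[0](raddf0 pi) quotient_map_eq subr0 ideal_pred1. Qed.

HB.instance Definition _ := GRing.Zmodule_isNzRing.Build (quotient I)
  qmulA qmul1 qmulr1 qmulDl qmulDr qone_neq0.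

Lemma quotient_map_monoid : monoid_morphism pi.
Proof. by split=> // x y; exact: pi_qmul. Qed.

HB.instance Definition _ :=
  GRing.isMonoidMorphism.Build R (quotient I) pi quotient_map_monoid.

End QuotientRing.

Section QuotientAlgebra.
Variables (k : fieldType) (A : lalgType k) (I : properIdeal A).

Local Notation pi := (@quotient_map A I).
Local Notation rep := (@quotient_repr A I).

Definition qscale (a : k) (x : quotient I) : quotient I := pi (a *: rep x).

Lemma pi_qscale a (x : A) : pi (a *: x) = qscale a (pi x).
Proof.
apply/eqP; rewrite quotient_map_eq -scalerBr -[_ - _]mul1r scalerAl.
by apply: ideal_predMl; exact: quotient_repr_map.
Qed.

Lemma qscaleA a b x : qscale a (qscale b x) = qscale (a * b) x.
Proof. by rewrite -[x]quotient_reprK -!pi_qscale scalerA. Qed.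

Lemma qscale1 : left_id 1 qscale.
Proof. by move=> x; rewrite -[x]quotient_reprK -pi_qscale scale1r. Qed.

Lemma qscaleDr : right_distributive qscale +%R.
Proof.
move=> a x y; rewrite -[x]quotient_reprK -[y]quotient_reprK.
by rewrite -raddfD -!pi_qscale -raddfD scalerDr.
Qed.

Lemma qscaleDl x : {morph qscale^~ x : a b / a + b}.
Proof.
by move=> a b; rewrite -[x]quotient_reprK -!pi_qscale -raddfD scalerDl.
Qed.

HB.instance Definition _ := GRing.Zmodule_isLmodule.Build k (quotient I)
  qscaleA qscale1 qscaleDr qscaleDl.

Lemma qscaleAl (a : k) (x y : quotient I) : a *: (x * y) = a *: x * y.
Proof.
change (qscale a (qmul x y) = qmul (qscale a x) y).
rewrite -[x]quotient_reprK -[y]quotient_reprK.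
by rewrite -pi_qmul -!pi_qscale -pi_qmul scalerAl.
Qed.

HB.instance Definition _ :=
  GRing.Lmodule_isLalgebra.Build k (quotient I) qscaleAl.

Lemma quotient_map_scalable : scalable pi.
Proof. by move=> a x; exact: pi_qscale. Qed.

HB.instance Definition _ :=
  GRing.isScalable.Build k A (quotient I) *:%R pi quotient_map_scalable.

End QuotientAlgebra.

Section LinearAlgebra.
Variable k : fieldType.

Definition span (M : lmodType k) (B : set M) : set M :=
  [set v | exists (s : seq M) (a : M -> k),
     (forall x, x \in s -> B x) /\ v = \sum_(x <- s) a x *: x].

Definition is_basis (M : lmodType k) (B : set M) : Prop :=
  (forall (s : seq M) (a : M -> k), uniq s -> (forall x, x \in s -> B x) ->
     \sum_(x <- s) a x *: x = 0 -> forall x, x \in s -> a x = 0)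
  /\ span B = setT.

Definition set_add (M : lmodType k) (A B : set M) : set M :=
  [set a + b | a in A & b in B].

(* {malg k[K]} is the vector space with basis K; [lin h] is the linear map
   sending each basis element << w >> to h w. *)
Definition lin (K : choiceType) (M : lmodType k) (h : K -> M)
    (p : {malg k[K]}) : M := \sum_(w <- msupp p) p@_w *: h w.

(* The tensor product of {malg k[K]} and {malg k[L]} is {malg k[K * L]}, with
   << u >> (x) << v >> = << (u, v) >>. *)
Definition tens (K L : choiceType) (p : {malg k[K]}) (q : {malg k[L]}) :
    {malg k[(K * L)%type]} := lin (fun u => lin (fun v => << (u, v) >>) q) p.

Definition tens_sub (K L : choiceType)
    (P : set {malg k[K]}) (Q : set {malg k[L]}) : set {malg k[(K * L)%type]} :=
  span [set tens p q | p in P & q in Q].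

End LinearAlgebra.

(* V, V (x) V, k<X> = T(V) and T(V) (x) T(V), for V with basis X; a word of
   length n stands for a basis vector of the n-th tensor power of V. *)
Notation "''V[' k , X ]" := {malg k[X]} (format "''V[' k ,  X ]").
Notation "''VV[' k , X ]" := {malg k[(X * X)%type]} (format "''VV[' k ,  X ]").
Notation "''T[' k , X ]" := {malg k[{fmonom X}]} (format "''T[' k ,  X ]").
Notation "''TT[' k , X ]" := {malg k[({fmonom X} * {fmonom X})%type]}
  (format "''TT[' k ,  X ]").

Section Words.
Variables (d : Order.disp_t) (X : finOrderType d).
Implicit Types u v w : seq X.

Definition lex_lt u v : bool := ((u : seqlexi X) < (v : seqlexi X))%O.
Definition lex_ge u v : bool := ((u : seqlexi X) >= (v : seqlexi X))%O.

Definition lyndon u : bool :=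
  (u != [::]) && [forall i : 'I_(size u), (0 < i)%N ==> lex_lt u (drop i u)].

(* The least i > 0 such that drop i u is Lyndon. *)
Definition shirshov_cut u : nat :=
  (find (fun i => lyndon (drop i.+1 u)) (iota 0 (size u))).+1.

Fixpoint factorizations u : seq (seq (seq X)) :=
  if u is x :: u' then
    flatten [seq ([:: x] :: f) ::
               (if f is w :: f' then [:: (x :: w) :: f'] else [::])
            | f <- factorizations u']
  else [:: [::]].

(* The factorization selected by the filter is unique. *)
Definition lyndon_dec u : seq (seq X) :=
  head [::] [seq f <- factorizations u | all lyndon f && sorted lex_ge f].

(* Strict part of the standard order: shorter words are larger. *)
Definition std_gt w u : bool :=
  (size w < size u)%N || (size w == size u) && lex_lt u w.

Definition wpow u (t : nat) : seq X := flatten (nseq t u).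

End Words.

Section FreeAlgebra.
Variables (k : fieldType) (d : Order.disp_t) (X : finOrderType d).

Local Notation V := 'V[k, X].
Local Notation VV := 'VV[k, X].
Local Notation T := 'T[k, X].
Local Notation TT := 'TT[k, X].

Definition mon (u : seq X) : T := << FMonom u >>.

(* A map r on V (x) V as a map on the degree 2 part of T(V). *)
Definition on_deg2 (r : VV -> VV) : T -> T :=
  lin (fun w : {fmonom X} => if fmonom_val w is [:: x; y]
    then lin (fun z => mon [:: z.1; z.2]) (r << (x, y) >>) else 0).

(* id (x) f, with id on the first n tensor factors *)
Definition id_tens (n : nat) (f : T -> T) : T -> T :=
  lin (fun w : {fmonom X} => mon (take n w) * f (mon (drop n w))).

(* f (x) id, with f on the first n tensor factors *)
Definition tens_id (n : nat) (f : T -> T) : T -> T :=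
  lin (fun w : {fmonom X} => f (mon (take n w)) * mon (drop n w)).

Definition braid_eq (r : VV -> VV) : Prop :=
  let r12 := tens_id 2 (on_deg2 r) in
  let r23 := id_tens 1 (on_deg2 r) in
  forall x y z : X,
    r12 (r23 (r12 (mon [:: x; y; z]))) = r23 (r12 (r23 (mon [:: x; y; z]))).

(* r_{1,m} and r_{n,m}, acting on the tensor power of degree n + m *)
Fixpoint braid1 (r : VV -> VV) (m : nat) : T -> T :=
  if m is m'.+1
  then id_tens 1 (braid1 r m') \o tens_id 2 (on_deg2 r) else id.

Fixpoint braid (r : VV -> VV) (n m : nat) : T -> T :=
  if n is n'.+1
  then tens_id (n' + m) (braid r n' m) \o id_tens n' (braid1 r m) else id.

(* r_{n,m} for all n and m, as one map on T(V) (x) T(V) *)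
Definition tbraid (r : VV -> VV) : TT -> TT :=
  lin (fun uw : {fmonom X} * {fmonom X} =>
    let n := size uw.1 in let m := size uw.2 in
    lin (fun z : {fmonom X} => tens (mon (take m z)) (mon (drop m z)))
        (braid r n m (mon (uw.1 ++ uw.2)))).

Definition mulT : TT -> T := lin (fun uw => << uw.1 >> * << uw.2 >>).

(* (m (x) m) (id (x) c (x) id) *)
Definition bmul (r : VV -> VV) (a b : TT) : TT :=
  lin (fun u : {fmonom X} * {fmonom X} =>
    lin (fun w : {fmonom X} * {fmonom X} =>
      lin (fun z : {fmonom X} * {fmonom X} =>
             tens (<< u.1 >> * << z.1 >> : T) (<< z.2 >> * << w.2 >> : T))
          (tbraid r (tens (<< u.2 >> : T) (<< w.1 >> : T)))) b) a.

(* The multiplicative extension of v |-> 1 (x) v + v (x) 1 *)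
Definition coprod (r : VV -> VV) : T -> TT :=
  lin (fun w : {fmonom X} =>
    foldr (fun x z => bmul r (tens (1 : T) (mon [:: x]) + tens (mon [:: x]) (1 : T)) z)
          (tens (1 : T) (1 : T)) w).

(* The algebra morphism vanishing on V takes the coefficient of the empty word. *)
Definition counit (p : T) : k := p@_(FMonom [::]).

Definition braided_biideal (c : VV -> VV) (I : properIdeal T) : Prop :=
  let J := set_add (tens_sub I setT) (tens_sub setT I) in
  [/\ forall p, ideal_set I p -> J (coprod c p),
      forall p, ideal_set I p -> counit p = 0 &
      tbraid c @` J = J].

Definition left_triangular (c : VV -> VV) : Prop :=
  exists (gamma : X -> X -> k) (v : X -> X -> X -> V), forall x y : X,
    c << (x, y) >> = gamma x y *: << (y, x) >>
      + \sum_(z : X | (y < z)%O) tens << z >> (v x y z).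

(* [u]_r for u Lyndon; n bounds the recursion depth, n = size u suffices. *)
Fixpoint lyndon_bracket (r : VV -> VV) (n : nat) (u : seq X) : T :=
  if n is n'.+1 then
    if (size u <= 1)%N then mon u else
    let i := shirshov_cut u in
    let t := tens (lyndon_bracket r n' (take i u))
                  (lyndon_bracket r n' (drop i u)) in
    mulT (t - tbraid r t)
  else 1.

Definition bracket (r : VV -> VV) : T -> T :=
  lin (fun w : {fmonom X} =>
    \prod_(l <- lyndon_dec w) lyndon_bracket r (size l) l).

(* k<X>_{> u} + I *)
Definition higher (I : set T) (u : seq X) : set T :=
  set_add (span [set mon w | w in [set w | std_gt w u]]) I.

Definition S_ (I : set T) : set (seqlexi X) :=
  [set u | lyndon u /\ ~ higher I u (mon u)].

(* Heights; None stands for infinity. *)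
Definition h_ (I : set T) (u : seqlexi X) : option nat :=
  match pselect (exists t, `[< higher I (wpow u t) (mon (wpow u t)) >]) with
  | left ex => Some (ex_minn ex)
  | right _ => None
  end.

End FreeAlgebra.

Section PBW.
Variables (k : fieldType) (d : Order.disp_t) (W : orderType d) (A : lalgType k).

Definition lt_height (e : nat) (h : option nat) : bool :=
  if h is Some n then (e < n)%N else true.

(* The PBW set generated by g @` S, with the order and the heights transported
   from S along g (assumed injective on S). *)
Definition pbw_set (S : set W) (h : W -> option nat) (g : W -> A) : set A :=
  [set p | exists s : seq (W * nat),
    [/\ sorted (fun a b => (b < a)%O) [seq we.1 | we <- s],
        forall we, we \in s -> [/\ S we.1, (0 < we.2)%N & lt_height we.2 (h we.1)] &
        p = \prod_(we <- s) g we.1 ^+ we.2]].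

End PBW.

Definition B_ (k : fieldType) (d : Order.disp_t) (X : finOrderType d)
    (I : set 'T[k, X]) : set 'T[k, X] :=
  pbw_set (S_ I) (h_ I) (@mon k d X : seqlexi X -> 'T[k, X]).

(* Main.v *)
(* Write u << v when v is larger than u at the first letter where they differ.
   Because c is left triangular, moving a right tensor factor past a word x in
   T(V) (x) T(V) multiplies x by a nonzero scalar, up to terms whose new left
   factor z has the length of x and satisfies x << z.

   A word u is irreducible when it is not in k<X>_{> u} + I.  For every family
   h(u) = u + (larger words), the h(u) with u irreducible form a basis modulo I;
   both the words and their commutators are such families.  So B_I has to be
   identified with the set of irreducible words.  Factors of irreducible words
   are irreducible, hence irreducible words are in B_I.

   For the converse, let b_l, for l Lyndon, be the iterated commutator with
   respect to the diagonal braiding x (x) y |-> gamma_{x,y} y (x) x, the leading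
   part of c.  Then b_l = l + (larger words), and the coproduct of b_l is
   b_l (x) 1 + 1 (x) b_l up to terms whose left factor is >> l.  If a word of B_I
   of length N were reducible, some nontrivial combination of the products of
   the b_l attached to words of B_I of length N would be in I up to lower degree.
   Take the smallest Lyndon factor l occurring in it and its highest multiplicity
   e.  As l^e is irreducible there is a functional g that vanishes on I and on
   k<X>_{> l^e}, with g(l^e) = 1.  Applying g to the left factor of the coproduct
   gives an element of I of degree N - e |l| whose leading word y is such that
   y l^e is in B_I, contradicting the irreducibility of y. *)
Require Import Defs.
From mathcomp Require Import all_boot all_order all_algebra finmap.
From mathcomp.multinomials Require Import monalg.
From mathcomp Require Import boolp classical_sets.
From HB Require Import structures.
From mathcomp Require Import ring zify.

Set Implicit Arguments.
Unset Strict Implicit.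
Unset Printing Implicit Defensive.

Import Order.TTheory GRing.Theory.

Local Open Scope classical_set_scope.
Local Open Scope ring_scope.

(** * Linear extensions and supports *)

(* Locked copies keep unification from unfolding sums and tensors. *)
HB.lock Definition lext (k : fieldType) (K : choiceType) (M : lmodType k)
  (h : K -> M) (p : {malg k[K]}) : M := lin h p.

Lemma lextE (k : fieldType) (K : choiceType) (M : lmodType k) (h : K -> M) p :
  lin h p = lext h p.
Proof. by rewrite lext.unlock. Qed.

Section Lin.
Variable k : fieldType.

Section OneModule.
Variables (K : choiceType) (M : lmodType k).
Implicit Types (p q : {malg k[K]}) (h : K -> M).

Lemma lextEw (D : {fset K}) h p : (msupp p `<=` D)%fset ->
  lext h p = \sum_(w <- D) p@_w *: h w.
Proof.
move=> le; rewrite lext.unlock /lin; apply: big_fset_incl le _ => w _ w_out.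
by rewrite mcoeff_outdom // scale0r.
Qed.

Lemma lext_is_linear h : linear (lext h).
Proof.
move=> a p q.
pose D := (msupp p `|` (msupp q `|` msupp (a *: p + q)))%fset.
have sp : (msupp p `<=` D)%fset by exact: fsubsetUl.
have sq : (msupp q `<=` D)%fset.
  by apply: fsubset_trans (fsubsetUr _ _); exact: fsubsetUl.
have spq : (msupp (a *: p + q) `<=` D)%fset.
  by apply: fsubset_trans (fsubsetUr _ _); exact: fsubsetUr.
rewrite (lextEw h sp) (lextEw h sq) (lextEw h spq) scaler_sumr -big_split /=.
by apply: eq_bigr => w _; rewrite mcoeffD mcoeffZ scalerDl scalerA.
Qed.

HB.instance Definition _ h := GRing.isLinear.Build k {malg k[K]} M *:%R (lext h)
  (lext_is_linear h).

Lemma lext_mon h w : lext h << w >> = h w.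
Proof. by rewrite lext.unlock /lin msuppU oner_eq0 big_seq_fset1 mcoeffUU scale1r. Qed.

Lemma eq_lext h h' p : (forall w, w \in msupp p -> h w = h' w) ->
  lext h p = lext h' p.
Proof. by move=> hh'; rewrite lext.unlock; apply: eq_big_seq => w /hh' ->. Qed.

Lemma lext_addf h h' p : lext (fun w => h w + h' w) p = lext h p + lext h' p.
Proof. by rewrite lext.unlock /lin -big_split; apply: eq_bigr => w _; rewrite scalerDr. Qed.

Lemma lext_scalef a h p : lext (fun w => a *: h w) p = a *: lext h p.
Proof.
by rewrite lext.unlock /lin scaler_sumr; apply: eq_bigr => w _; rewrite !scalerA mulrC.
Qed.

Lemma lext_oppf h p : lext (fun w => - h w) p = - lext h p.
Proof. by rewrite lext.unlock /lin -sumrN; apply: eq_bigr => w _; rewrite scalerN. Qed.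

Lemma malg_basis p : p = \sum_(w <- msupp p) p@_w *: << w >>.
Proof.
rewrite {1}[p]monalgE; apply: eq_bigr => w _; apply/malgP => v.
by rewrite mcoeffZ !mcoeffU mulrnAr mulr1.
Qed.

Lemma linear_lext (f : {linear {malg k[K]} -> M}) p :
  f p = lext (fun w => f << w >>) p.
Proof.
rewrite lext.unlock {1}[p]malg_basis linear_sum.
by apply: eq_bigr => w _; rewrite linearZ.
Qed.

End OneModule.

Lemma lext_id (K : choiceType) (p : {malg k[K]}) : lext (fun w => << w >>) p = p.
Proof. by rewrite lext.unlock [RHS]malg_basis. Qed.

Lemma linear_lextE (K : choiceType) (M N : lmodType k) (f : {linear M -> N})
  (h : K -> M) p : f (lext h p) = lext (fun w => f (h w)) p.
Proof. by rewrite lext.unlock linear_sum; apply: eq_bigr => w _; rewrite linearZ. Qed.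

Lemma lext_lext (K L : choiceType) (M : lmodType k) (h : L -> M)
    (g : K -> {malg k[L]}) p :
  lext h (lext g p) = lext (fun w => lext h (g w)) p.
Proof. exact: (linear_lextE (lext h)). Qed.

Lemma lext_swap (K L : choiceType) (M : lmodType k) (F : K -> L -> M) p q :
  lext (fun u => lext (F u) q) p = lext (fun v => lext (F^~ v) p) q.
Proof.
rewrite lext.unlock /lin; under eq_bigr do rewrite scaler_sumr.
rewrite exchange_big; apply: eq_bigr => v _ /=; rewrite scaler_sumr.
by apply: eq_bigr => u _; rewrite !scalerA mulrC.
Qed.

End Lin.

(** * Supports of finite linear combinations *)

Section Support.
Variables (k : fieldType) (K : choiceType).
Implicit Types (P Q : K -> Prop) (p q : {malg k[K]}).

Definition supp P p : Prop := forall w, w \in msupp p -> P w.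

Lemma suppP P p : supp P p <-> forall w, ~ P w -> p@_w = 0.
Proof.
split=> [Pp w nPw|Pp w].
  by apply: mcoeff_outdom; apply/negP => /Pp.
by rewrite -mcoeff_neq0 => /eqP pw; apply: contrapT => /Pp.
Qed.

Lemma supp_sub P Q p : (forall w, P w -> Q w) -> supp P p -> supp Q p.
Proof. by move=> PQ Pp w /Pp /PQ. Qed.

Lemma supp0 P : supp P 0. Proof. by move=> w; rewrite msupp0. Qed.

Lemma suppD P p q : supp P p -> supp P q -> supp P (p + q).
Proof.
move=> /suppP Pp /suppP Pq; apply/suppP => w nPw.
by rewrite mcoeffD Pp // Pq // addr0.
Qed.

Lemma suppN P p : supp P p -> supp P (- p).
Proof. by move=> /suppP Pp; apply/suppP => w nPw; rewrite mcoeffN Pp ?oppr0. Qed.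

Lemma suppB P p q : supp P p -> supp P q -> supp P (p - q).
Proof. by move=> Pp Pq; apply: suppD => //; apply: suppN. Qed.

Lemma suppZ P a p : supp P p -> supp P (a *: p).
Proof. by move=> /suppP Pp; apply/suppP => w nPw; rewrite mcoeffZ Pp ?mulr0. Qed.

Lemma supp_mon P w : P w -> supp P << w >>.
Proof. by move=> Pw v; rewrite msuppU oner_eq0 inE => /eqP ->. Qed.

Lemma supp_sum P (I : eqType) (r : seq I) (F : I -> {malg k[K]}) :
  (forall i, i \in r -> supp P (F i)) -> supp P (\sum_(i <- r) F i).
Proof.
move=> PF; rewrite big_seq; elim/big_ind: _ => [|p q|i]; first exact: supp0.
  exact: suppD.
exact: PF.
Qed.

Lemma supp_subl P p q : supp P (p - q) -> supp P q -> supp P p.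
Proof. by move=> Ppq Pq; rewrite -[p](subrK q); apply: suppD. Qed.

Lemma supp_mcoeff0 P p : supp P p -> (forall w, ~ P w) -> p = 0.
Proof. by move=> /suppP Pp nP; apply/malgP => w; rewrite mcoeff0 Pp. Qed.

End Support.

Lemma supp_lext (k : fieldType) (K L : choiceType) (P : K -> Prop)
    (Q : L -> Prop) (h : K -> {malg k[L]}) p :
  supp P p -> (forall w, P w -> supp Q (h w)) -> supp Q (lext h p).
Proof. by move=> Pp PQ; rewrite lext.unlock; apply: supp_sum => w /Pp /PQ; apply: suppZ. Qed.

(** The witnesses found for the basis vectors are combined with the coefficients of [p]. This passes
    from solutions for single words to solutions for combinations without choosing a linear
    section. *)
Lemma basis_lift (k : fieldType) (K : choiceType) (M : lmodType k)
    (R : {malg k[K]} -> M -> Prop) (P : K -> Prop) p :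
  R 0 0 -> (forall e a b a' b', R a b -> R a' b' -> R (e *: a + a') (e *: b + b')) ->
  (forall w, P w -> exists q, R << w >> q) ->
  supp P p -> exists q, R p q.
Proof.
move=> R0 Rlin RP Pp.
have H (s : seq K) : {subset s <= msupp p} ->
    exists q, R (\sum_(w <- s) p@_w *: << w >>) q.
  elim: s => [|w s IH] sub; first by exists 0; rewrite big_nil.
  have [|q Rq] := IH; first by move=> v vs; apply: sub; rewrite inE vs orbT.
  have [|q' Rq'] := RP w; first by apply: Pp; apply: sub; rewrite mem_head.
  by exists (p@_w *: q' + q); rewrite big_cons; apply: Rlin.
by have [//|q Rq] := H (msupp p); exists q; rewrite [p]malg_basis.
Qed.

(** * Lyndon words *)

Section WordOrder.
Variables (d : Order.disp_t) (X : finOrderType d).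
Implicit Types (u v w a b : seq X) (x y : X).

(* The part [u << v] of the lexicographical order that is stable under
   extending both words on the right; false when one is a prefix of the other. *)
Fixpoint dom u v : bool :=
  match u, v with
  | x :: u', y :: v' => (x < y)%O || (x == y) && dom u' v'
  | _, _ => false
  end.

Lemma domxx u : dom u u = false.
Proof. by elim: u => //= x u ->; rewrite ltxx eqxx. Qed.

Lemma dom_cat2l a u v : dom (a ++ u) (a ++ v) = dom u v.
Proof. by elim: a => //= x a ->; rewrite ltxx eqxx. Qed.

Lemma dom_cat u v a b : dom u v -> dom (u ++ a) (v ++ b).
Proof.
elim: u v => [|x u IH] [|y v] //= /orP[->//|/andP[-> /IH ->]].
by rewrite orbT.
Qed.

Lemma dom_catr u v b : dom u v -> dom u (v ++ b).
Proof. by move=> /(dom_cat [::] b); rewrite cats0. Qed.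

Lemma dom_catl u v a : dom u v -> dom (u ++ a) v.
Proof. by move=> /(dom_cat a [::]); rewrite cats0. Qed.

(** A comparison with [v] is decided within the first [size v] letters, and these lie in [u]. *)
Lemma dom_catl_size u v a : (size v <= size u)%N -> dom (u ++ a) v -> dom u v.
Proof.
elim: u v => [|x u IH] [|y v] //=; first by case: a.
by rewrite ltnS => /IH le /orP[->//|/andP[-> /le ->]]; rewrite orbT.
Qed.

Lemma dom_trans v u w : dom u v -> dom v w -> dom u w.
Proof.
elim: u v w => [|x u IH] [|y v] [|z w] //=.
case/orP=> [xy|/andP[/eqP-> uv]].
  by case/orP=> [/(lt_trans xy)->//|/andP[/eqP <- _]]; rewrite xy.
by case/orP=> [->//|/andP[-> /(IH _ _ uv) ->]]; rewrite orbT.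
Qed.

Lemma lex_ltE u v : lex_lt u v = dom u v || prefix u v && (u != v).
Proof.
rewrite /lex_lt; elim: u v => [|x u IH] [|y v] //=.
rewrite ltxi_cons IH eqseq_cons; case: (ltgtP x y) => //= [->].
Qed.

Lemma lex_lt_size u v : size u = size v -> lex_lt u v = dom u v.
Proof.
move=> uv; rewrite lex_ltE prefixE uv take_size.
by rewrite [v == u]eq_sym andbN orbF.
Qed.

(** The other way of being lexicographically smaller is to be a proper prefix, which the lengths
    exclude. *)
Lemma lex_lt_dom u v : (size v <= size u)%N -> lex_lt u v -> dom u v.
Proof.
move=> vu; rewrite lex_ltE => /orP[//|/andP[/prefixP[t vE]]].
move: vu; rewrite vE size_cat -{2}[size u]addn0 leq_add2l leqn0 => /nilP ->.
by rewrite cats0 eqxx.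
Qed.

Lemma dom_lex_lt u v : dom u v -> lex_lt u v.
Proof. by rewrite lex_ltE => ->. Qed.

Lemma lex_lt_trans v u w : lex_lt u v -> lex_lt v w -> lex_lt u w.
Proof. exact: lt_trans. Qed.

Lemma lex_ltxx u : lex_lt u u = false.
Proof. exact: ltxx. Qed.

Lemma lex_geE u v : lex_ge u v = ~~ lex_lt u v.
Proof. by rewrite /lex_ge /lex_lt leNgt. Qed.

Lemma lex_lt_total u v : [\/ lex_lt u v, u = v | lex_lt v u].
Proof.
rewrite /lex_lt; case: (ltgtP (u : seqlexi X) v).
- by constructor 1.
- by constructor 3.
- by constructor 2.
Qed.

Lemma lex_ge_trans : transitive (@lex_ge _ X).
Proof. by move=> v u w uv vw; apply: le_trans vw uv. Qed.

Lemma lex_lt_cat2l a u v : lex_lt (a ++ u) (a ++ v) = lex_lt u v.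
Proof. by elim: a => //= x a <-; rewrite /lex_lt ltxi_cons lexx. Qed.

Lemma lyndonP u : reflect (u <> [::] /\
    forall a b, u = a ++ b -> a <> [::] -> b <> [::] -> lex_lt u b)
  (lyndon u).
Proof.
apply: (iffP andP) => [[/eqP u0 /forallP H]|[u0 H]]; split => //.
- move=> a b uE a0 b0.
  have lt : (size a < size u)%N.
    by rewrite uE size_cat -{1}[size a]addn0 ltn_add2l lt0n; case: (b) b0.
  have /implyP := H (Ordinal lt); rewrite lt0n /= [X in drop _ X]uE drop_size_cat //.
  by apply; case: (a) a0.
- exact/eqP.
apply/forallP => i; apply/implyP => i0.
apply: (H (take i u)); rewrite ?cat_take_drop //.
  by case: (u) i i0 => [[[]]|x s [[]]].
by move=> /(congr1 size)/eqP; rewrite size_drop subn_eq0 leqNgt ltn_ord.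
Qed.

Lemma lyndon_neq0 u : lyndon u -> u <> [::].
Proof. by case/lyndonP. Qed.

Lemma lyndon1 x : lyndon [:: x].
Proof. by apply/lyndonP; split=> // [[|y [|? ?]]] [|? ?] //= []. Qed.

Lemma lyndon_cat_lt v w : lyndon (v ++ w) -> v <> [::] -> w <> [::] ->
  lex_lt (v ++ w) w.
Proof. by case/lyndonP=> _ H v0 w0; apply: (H v w). Qed.

Lemma lyndon_cat_dom v w : lyndon (v ++ w) -> v <> [::] -> w <> [::] ->
  dom (v ++ w) w.
Proof.
by move=> lvw v0 w0; apply/lex_lt_dom; [rewrite size_cat leq_addl|apply: lyndon_cat_lt].
Qed.

(** A proper ending of [u ++ v] is either an ending of [v], handled through [u ++ v < v], or a
    proper ending of [u] followed by [v]; that ending of [u] already dominates [u], and this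
    survives extension on the right. *)
Lemma lyndon_cat u v : lyndon u -> lyndon v -> lex_lt u v -> lyndon (u ++ v).
Proof.
move=> /[dup] lu /lyndonP[u0 Hu] /[dup] lv /lyndonP[v0 Hv] uv.
(* Either [u] and [v] differ at some letter, or [v = u ++ t], and then [v < t] because [v] is
   Lyndon. *)
have uvv : lex_lt (u ++ v) v.
  move: uv; rewrite lex_ltE => /orP[uv|/andP[/prefixP[t vE] ne]].
    exact/dom_lex_lt/dom_catl.
  have t0 : t <> [::] by move=> t0; move: ne; rewrite vE t0 cats0 eqxx.
  by rewrite {2}vE lex_lt_cat2l; apply: (Hv u).
apply/lyndonP; split=> [/eqP|a b uvE a0 b0].
  by rewrite -size_eq0 size_cat addn_eq0 size_eq0 => /andP[/eqP].
case: (leqP (size u) (size a)) => le.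
  have vE : v = drop (size u) a ++ b.
    have := congr1 (drop (size u)) uvE; rewrite drop_size_cat // drop_cat.
    by case: ltngtP le => // e _; rewrite e drop_size subnn drop0.
  case: (drop (size u) a =P [::]) => [e|ne].
    by rewrite e /= in vE; rewrite -vE.
  exact: lex_lt_trans uvv (Hv _ _ vE ne b0).
have uE : u = a ++ drop (size a) u.
  have := congr1 (take (size a)) uvE; rewrite take_cat le take_size_cat // => aE.
  by rewrite -{1}aE cat_take_drop.
have bE : b = drop (size a) u ++ v.
  by move: uvE; rewrite uE -catA => /eqP; rewrite eqseq_cat // => /andP[_ /eqP <-]; rewrite -uE.
rewrite bE; apply/dom_lex_lt/dom_cat; rewrite {1}uE.
apply: lyndon_cat_dom => //; first by rewrite -uE.
by move=> /(congr1 size)/eqP; rewrite size_drop subn_eq0 leqNgt le.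
Qed.

End WordOrder.

(** * Lyndon and Shirshov decompositions *)

Section LyndonDecomposition.
Variables (d : Order.disp_t) (X : finOrderType d).
Implicit Types (u v w a b l : seq X) (x y : X) (f g : seq (seq X)).

Lemma sorted_cons_ge l f : sorted (@lex_ge _ X) (l :: f) =
  all (lex_ge l) f && sorted (@lex_ge _ X) f.
Proof. by rewrite /= path_sortedE //; exact: lex_ge_trans. Qed.

(** If [l] is smaller than the first factor, the two merge into a longer Lyndon word, and the
    merging continues to the right. *)
Lemma lyndon_fact_cons l f : lyndon l -> all (@lyndon _ X) f ->
  sorted (@lex_ge _ X) f ->
  exists g, [/\ flatten g = l ++ flatten f, all (@lyndon _ X) g
              & sorted (@lex_ge _ X) g].
Proof.
elim: f l => [|m f IH] l ll; first by exists [:: l]; rewrite /= ll.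
move=> /= /andP[lm lf] sf.
case: (boolP (lex_lt l m)) => lt; last first.
  by exists [:: l, m & f]; rewrite /= ll lm lf sf lex_geE lt.
have [|g [gE lg sg]] := IH (l ++ m) (lyndon_cat ll lm lt) lf.
  exact: path_sorted sf.
by exists g; rewrite gE catA.
Qed.

Lemma lyndon_fact u : exists f, [/\ flatten f = u, all (@lyndon _ X) f
  & sorted (@lex_ge _ X) f].
Proof.
elim: u => [|x u [f [<- lf sf]]]; first by exists [::].
exact: (lyndon_fact_cons (lyndon1 x)).
Qed.

Lemma prefix_lex_le u v : prefix u v -> ~~ lex_lt v u.
Proof.
move=> /prefixP[t ->]; rewrite -{2}[u]cats0 lex_lt_cat2l.
by rewrite /lex_lt -leNgt lexi0s.
Qed.

(** Take for [r] the part of [p] inside the factor of [f] where [p] stops: it is a prefix of a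
    factor that is at most [l]. *)
Lemma prefix_flatten_split p l f : p <> [::] -> prefix p (flatten f) ->
  all (lex_ge l) f ->
  exists q r, [/\ p = q ++ r, r <> [::] & ~~ lex_lt l r].
Proof.
elim: f p => [|m f IH] p p0 /=; first by case: p p0.
move=> pre /andP[lm lf]; case: (leqP (size p) (size m)) => le.
  exists [::], p; split => //.
  have pm : prefix p m.
    move: pre; rewrite !prefixE take_cat; case: ltngtP le => // e _.
    by rewrite e subnn take0 cats0 take_size.
  apply/negP => lp; have := prefix_lex_le pm; rewrite lex_geE in lm.
  by case: (lex_lt_total m p) => [->//|e|mp]; [rewrite e lp in lm|
    move: lm; rewrite (lex_lt_trans lp mp)].
have pE : p = m ++ drop (size m) p.
  rewrite -{1}[p](cat_take_drop (size m)); congr (_ ++ _).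
  move: pre; rewrite prefixE => /eqP {1}<-.
  by rewrite take_takel ?(ltnW le) // take_size_cat.
have := IH (drop (size m) p); case.
- by move=> /(congr1 size)/eqP; rewrite size_drop subn_eq0 leqNgt le.
- by move: pre; rewrite {1}pE prefix_catr ?eqxx.
- exact: lf.
by move=> q [r [e r0 lr]]; exists (m ++ q), r; split => //; rewrite pE e catA.
Qed.

(** A longer [m] would be [l] followed by a nonempty beginning of [flatten f], so it would have an
    ending [r <= l]. Since [m] is Lyndon with prefix [l], also [r > m >= l]. *)
Lemma lyndon_fact_head_size l f m g : lyndon l -> lyndon m ->
  all (lex_ge l) f ->
  l ++ flatten f = m ++ flatten g -> (size m <= size l)%N.
Proof.
move=> /lyndonP[l0 _] lm lf e; rewrite leqNgt; apply/negP => lt.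
have mE : m = l ++ drop (size l) m.
  have := congr1 (take (size l)) e.
  by rewrite take_size_cat // take_cat lt => {1}->; rewrite cat_take_drop.
have fE : flatten f = drop (size l) m ++ flatten g.
  have := congr1 (drop (size l)) e; rewrite drop_size_cat // drop_cat lt => ->//.
have [||q [r [rE r0 lr]]] := @prefix_flatten_split (drop (size l) m) l f _ _ lf.
- by move=> /(congr1 size)/eqP; rewrite size_drop subn_eq0 leqNgt lt.
- by rewrite fE prefix_prefix.
have lq0 : l ++ q <> [::] by case: (l) l0.
have mE' : m = (l ++ q) ++ r by rewrite mE rE catA.
have := @lyndon_cat_lt _ _ (l ++ q) r; rewrite -mE' => /(_ lm lq0 r0) mr.
have := @prefix_lex_le l m; rewrite {1}mE prefix_prefix => /(_ isT).
case: (lex_lt_total l r) lr => [->//|e' _|rl _].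
  by rewrite e' mr.
by rewrite (lex_lt_trans mr rl).
Qed.

Lemma lyndon_fact_uniq f g : all (@lyndon _ X) f -> sorted (@lex_ge _ X) f ->
  all (@lyndon _ X) g -> sorted (@lex_ge _ X) g -> flatten f = flatten g ->
  f = g.
Proof.
elim: f g => [|l f IH] [|m g] //.
- by move=> _ _ /= /andP[/lyndon_neq0 m0 _] _ /esym/eqP; case: (m) m0.
- by move=> /= /andP[/lyndon_neq0 l0 _] _ _ _ /eqP; case: (l) l0.
rewrite !sorted_cons_ge => /= /andP[ll alf] /andP[lf sf].
move=> /andP[lm alg] /andP[mg sg] e.
have sz : size l = size m.
  apply/eqP; rewrite eqn_leq (lyndon_fact_head_size lm ll mg (esym e)).
  by rewrite (lyndon_fact_head_size ll lm lf e).
move/eqP: e; rewrite eqseq_cat // => /andP[/eqP -> /eqP e].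
by rewrite (IH g).
Qed.

Lemma mem_factorizations u f :
  (f \in factorizations u) = (flatten f == u) && ([::] \notin f).
Proof.
elim: u f => [|x u IH] f /=.
  rewrite inE; case: f => [|[|? ?] f] //=.
  by rewrite andbF.
apply/flattenP/idP => [[s /mapP[g]]|].
  rewrite IH => /andP[/eqP gu g0] ->; rewrite inE => /orP[/eqP->|].
    by rewrite /= gu eqxx inE g0.
  case: g gu g0 => [|w g] //= gu; rewrite inE negb_or => /andP[w0 g0].
  by rewrite inE => /eqP ->; rewrite /= gu eqxx inE g0.
case: f => [|[|y [|z w]] f] //=.
- by rewrite andbF.
- move=> /andP[/eqP[-> fu]]; rewrite inE negb_or => /= f0.
  eexists; first by apply/mapP; exists f; [rewrite IH fu eqxx|reflexivity].
  by rewrite inE eqxx.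
move=> /andP[/eqP[-> fu]]; rewrite inE negb_or => /= f0.
eexists; first by apply/mapP; exists ((z :: w) :: f); [rewrite IH /= fu eqxx inE|reflexivity].
by rewrite !inE eqxx orbT.
Qed.

Lemma lyndon_dec_spec u : [/\ flatten (lyndon_dec u) = u,
  all (@lyndon _ X) (lyndon_dec u) & sorted (@lex_ge _ X) (lyndon_dec u)].
Proof.
have [f [fu lf sf]] := lyndon_fact u.
have : f \in [seq f <- factorizations u | all (@lyndon _ X) f && sorted (@lex_ge _ X) f].
  rewrite mem_filter lf sf mem_factorizations fu eqxx /=.
  by apply/negP => /(allP lf)/lyndon_neq0.
have sub g : g \in [seq f <- factorizations u | all (@lyndon _ X) f
    && sorted (@lex_ge _ X) f] ->
    [/\ flatten g = u, all (@lyndon _ X) g & sorted (@lex_ge _ X) g].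
  by rewrite mem_filter mem_factorizations => /andP[/andP[? ?] /andP[/eqP ? _]].
rewrite /lyndon_dec; case: [seq _ <- _ | _] sub => //= g s sub _.
by apply: sub; rewrite mem_head.
Qed.

Lemma lyndon_dec_eq f : all (@lyndon _ X) f -> sorted (@lex_ge _ X) f ->
  lyndon_dec (flatten f) = f.
Proof.
move=> lf sf; have [e ld sd] := lyndon_dec_spec (flatten f).
exact: lyndon_fact_uniq ld sd lf sf e.
Qed.

Lemma lyndon_dec1 l : lyndon l -> lyndon_dec l = [:: l].
Proof. by move=> ll; rewrite -{1}[l]cats0 (@lyndon_dec_eq [:: l]) //= ll. Qed.

(* The Shirshov decomposition: if the left part were not Lyndon, its last
   Lyndon factor could be merged with the right part, or the decomposition of
   the left part would extend to one of the whole word. *)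
Lemma shirshov_spec u : lyndon u -> (1 < size u)%N ->
  exists v w, [/\ u = v ++ w, lyndon v, lyndon w & shirshov_cut u = size v].
Proof.
move=> lu u1; set i := shirshov_cut u.
(* The last letter is a Lyndon word, so the search in [shirshov_cut] succeeds. *)
have hs : has (fun i => lyndon (drop i.+1 u)) (iota 0 (size u)).
  apply/hasP; exists (size u).-2; first by rewrite mem_iota /= add0n; case: (u) u1 => [|? [|? ?]].
  rewrite [_.-2.+1](_ : _ = (size u).-1); last by case: (u) u1 => [|? [|? ?]].
  case: (lastP u) u1 => // s x; rewrite size_rcons -cats1 drop_size_cat // => _.
  exact: lyndon1.
have j_lt := hs; rewrite has_find size_iota in j_lt.
have lw : lyndon (drop i u).
  by have := nth_find 0%N hs; rewrite nth_iota ?add0n.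
have i_lt : (i < size u)%N.
  by case: (ltnP i (size u)) => // /drop_oversize e; move: lw; rewrite e.
have min j : (0 < j < i)%N -> ~~ lyndon (drop j u).
  case: j => // j /= ji.
  have ji' : (j < find (fun i => lyndon (drop i.+1 u)) (iota 0 (size u)))%N.
    by [].
  have := before_find 0%N ji'; rewrite nth_iota ?add0n; first by move=> /negbT.
  exact: ltn_trans ji' j_lt.
exists (take i u), (drop i u); split=> //; rewrite ?cat_take_drop //; last first.
  by rewrite size_take i_lt.
have [f [fE lf sf]] := lyndon_fact (take i u).
case: (lastP f) fE lf sf => [/(congr1 size)|g m].
  by rewrite size_take i_lt.
rewrite -cats1 flatten_cat /= cats0 all_cat /= andbT => gE /andP[lg lm] sf.
case: g => [|l g] in gE lg sf *; first by rewrite -gE.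
have uE : u = flatten (l :: g) ++ (m ++ drop i u).
  by rewrite catA gE cat_take_drop.
case: (boolP (lex_lt m (drop i u))) => lt.
  have := min (size (flatten (l :: g))); rewrite [X in drop _ X]uE drop_size_cat //.
  rewrite (lyndon_cat lm lw lt) => H.
  suff j_i : (0 < size (flatten (l :: g)) < i)%N by have := H j_i.
  have -> : i = size (flatten (l :: g) ++ m) by rewrite gE size_take i_lt.
  rewrite size_cat -{2}[size (flatten _)]addn0 ltn_add2l !lt0n !size_eq0.
  have /andP[/lyndon_neq0 l0 _] := lg.
  by apply/andP; split; [case: (l) l0|apply/eqP/lyndon_neq0].
have e : [:: u] = l :: (g ++ [:: m; drop i u]).
  apply: lyndon_fact_uniq => //=; rewrite ?lu //.
  - by move: lg => /= /andP[-> lg]; rewrite all_cat lg /= lm lw.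
  - move: sf; rewrite /= !cat_path /= => /andP[-> /andP[-> _]] /=.
    by rewrite lex_geE lt.
  by rewrite /= cats0 flatten_cat /= cats0 {1}uE /= !catA.
by case: (g) e => [|? ?] [].
Qed.

Lemma wpowS l n : wpow l n.+1 = l ++ wpow l n. Proof. by []. Qed.

Lemma wpowD l m n : wpow l (m + n) = wpow l m ++ wpow l n.
Proof. by rewrite /wpow nseqD flatten_cat. Qed.

Lemma wpow1 l : wpow l 1 = l. Proof. exact: cats0. Qed.

Lemma size_wpow l n : size (wpow l n) = (n * size l)%N.
Proof. by elim: n => //= n IH; rewrite wpowS size_cat IH mulSn. Qed.

(* [z] is lexicographically larger than the infinite word [l l l ...]. *)
Definition dom_inf l z := exists n, dom (wpow l n) z.

(** Induction over the endings [b] of [m], all of which are larger than [l]. If [l] is a prefix of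
    [b], one copy of [l] is removed on both sides, and what is left of [b] is again a nonempty
    ending of [m]. *)
Lemma dom_inf_lyndon l m : l != [::] -> lyndon m -> lex_lt l m -> dom_inf l m.
Proof.
move=> l0 lm lt.
have H n a b : (size b <= n)%N -> m = a ++ b -> b <> [::] -> dom_inf l b.
  elim: n a b => [|n IH] a b; first by case: b.
  move=> bn mE b0.
  have : lex_lt l b.
    case: (a =P [::]) => [a0|a0]; first by rewrite a0 /= in mE; rewrite -mE.
    apply: lex_lt_trans lt _; rewrite mE; apply: lyndon_cat_lt => //.
    by rewrite -mE.
  rewrite lex_ltE => /orP[lb|/andP[/prefixP[t bE] ne]].
    by exists 1%N; rewrite wpow1.
  have t0 : t <> [::] by move=> t0; move: ne; rewrite bE t0 cats0 eqxx.
  have [||q dq] := IH (a ++ l) t _ _ t0; last by exists q.+1; rewrite wpowS bE dom_cat2l.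
    move: bn; rewrite bE size_cat => bn; rewrite -ltnS; apply: leq_trans bn.
    by rewrite -{1}[size t]add0n ltn_add2r lt0n size_eq0.
  by rewrite mE bE catA.
by apply: (H (size m) [::] m) => //; apply: lyndon_neq0.
Qed.
End LyndonDecomposition.

(** * The braided tensor product *)

HB.lock Definition mon2 (k : fieldType) (d : Order.disp_t) (X : finOrderType d)
  (u v : seq X) : 'TT[k, X] := << (FMonom u, FMonom v) >>.

HB.lock Definition bprod (k : fieldType) (d : Order.disp_t) (X : finOrderType d)
  (c : 'VV[k, X] -> 'VV[k, X]) (a b : 'TT[k, X]) : 'TT[k, X] := bmul c a b.

HB.lock Definition cop (k : fieldType) (d : Order.disp_t) (X : finOrderType d)
  (c : 'VV[k, X] -> 'VV[k, X]) (a : 'T[k, X]) : 'TT[k, X] := coprod c a.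

Section BraidedTensorProduct.
Variables (k : fieldType) (d : Order.disp_t) (X : finOrderType d).

Local Notation VV := 'VV[k, X].
Local Notation T := 'T[k, X].
Local Notation TT := 'TT[k, X].
Local Notation mon := (@mon k d X).
Local Notation mon2 := (@mon2 k d X).
Implicit Types (u v p q r s : seq X) (x y : X).

Definition suppT (P : seq X -> Prop) (a : T) : Prop :=
  supp (fun w : {fmonom X} => P w) a.

Definition suppTT (P : seq X -> seq X -> Prop) (a : TT) : Prop :=
  supp (fun z : {fmonom X} * {fmonom X} => P z.1 z.2) a.

Lemma fmonomK (w : {fmonom X}) : FMonom (w : seq X) = w.
Proof. by case: w. Qed.

Lemma fmonomE u : (FMonom u : seq X) = u. Proof. by []. Qed.

Lemma mon_val (w : {fmonom X}) : << w >> = mon w :> T.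
Proof. by rewrite /Defs.mon fmonomK. Qed.

Lemma mon2_val (z : {fmonom X} * {fmonom X}) : << z >> = mon2 z.1 z.2 :> TT.
Proof. by rewrite mon2.unlock; case: z => [[u] [v]]. Qed.

Lemma monM u v : mon u * mon v = mon (u ++ v).
Proof. by rewrite malgM_def fgmulUU mulr1 /mmul /= fmmulE. Qed.

Lemma mon0 : mon [::] = 1.
Proof. by rewrite /Defs.mon -fmoneE. Qed.

Lemma lext_monT (M : lmodType k) (h : {fmonom X} -> M) u :
  lext h (mon u) = h (FMonom u).
Proof. exact: lext_mon. Qed.

Lemma lext_mon2 (M : lmodType k) (h : {fmonom X} * {fmonom X} -> M) u v :
  lext h (mon2 u v) = h (FMonom u, FMonom v).
Proof. by rewrite mon2.unlock lext_mon. Qed.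

Lemma lext_mulr (K : choiceType) (h : K -> T) (p : {malg k[K]}) (a : T) :
  lext h p * a = lext (fun w => h w * a) p.
Proof.
rewrite lext.unlock mulr_suml.
by apply: eq_bigr => w _; rewrite scalerAl.
Qed.

Lemma malg_scalerAr (e : k) (a b : T) : a * (e *: b) = e *: (a * b).
Proof.
apply/malgP => t; rewrite mcoeffZ [in RHS]mcoeffMl.
refine (etrans (mcoeffMlw t (fsubset_refl _) (msuppZ_le e b)) _).
rewrite mulr_sumr; apply: eq_bigr => u _; rewrite mulr_sumr.
by apply: eq_bigr => v _; rewrite mcoeffZ mulrnAr mulrCA.
Qed.

Lemma lext_mull (K : choiceType) (h : K -> T) (p : {malg k[K]}) (a : T) :
  a * lext h p = lext (fun w => a * h w) p.
Proof.
rewrite lext.unlock mulr_sumr.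
by apply: eq_bigr => w _; rewrite malg_scalerAr.
Qed.

Lemma mulTE (a b : T) : a * b =
  lext (fun u : {fmonom X} => lext (fun v : {fmonom X} => mon (u ++ v)) b) a.
Proof.
rewrite -{1}[a]lext_id lext_mulr; apply: eq_lext => u _.
rewrite -{1}[b]lext_id lext_mull; apply: eq_lext => v _.
by rewrite !mon_val monM.
Qed.

Lemma tens_mon u v : tens (mon u) (mon v) = mon2 u v.
Proof. by rewrite /tens !lextE !lext_monT lextE lext_monT mon2.unlock. Qed.

Variable c : VV -> VV.
Local Notation bprod := (bprod c).
Local Notation cop := (cop c).

(** The map [c_{1,m}] on [x (x) r]: the letter travels through [r] from left to right. Working with
    pairs keeps the two tensor factors apart, whereas [braid1] concatenates them. *)
Fixpoint braid_letter x r : {malg k[(seq X * X)%type]} :=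
  if r is y :: r' then
    lext (fun yx => lext (fun rx => << (yx.1 :: rx.1, rx.2) >>)
                       (braid_letter yx.2 r')) (c << (x, y) >>)
  else << ([::], x) >>.

(** The map [c_{n,m}] on [q (x) r]: the letters of [q] pass through [r] one by one, the last letter
    first. *)
Fixpoint braid_word q r : {malg k[(seq X * seq X)%type]} :=
  if q is x :: q' then
    lext (fun rq => lext (fun rx => << (rx.1, rx.2 :: rq.2) >>)
                       (braid_letter x rq.1)) (braid_word q' r)
  else << (r, [::]) >>.

(** The letter passes [p] first, and whatever letter comes out then passes [r]. Associativity of the
    braided product rests on this. *)
Lemma braid_letter_cat x p r : braid_letter x (p ++ r) =
  lext (fun t => lext (fun t' => << (t.1 ++ t'.1, t'.2) >>) (braid_letter t.2 r))
      (braid_letter x p).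
Proof.
elim: p x => [|y p IH] x /=.
  by rewrite lext_mon /= -[LHS]lext_id; apply: eq_lext => -[].
rewrite lext_lext; apply: eq_lext => yx _; rewrite IH !lext_lext.
by apply: eq_lext => t _; rewrite lext_mon lext_lext; apply: eq_lext => t' _; rewrite lext_mon.
Qed.

Lemma braid_word1 x r :
  braid_word [:: x] r = lext (fun t => << (t.1, [:: t.2]) >>) (braid_letter x r).
Proof. by rewrite /= lext_mon. Qed.

(** This is the recursion of [braid], which splits off the last letter of the left word, while
    [braid_word] splits off the first. *)
Lemma braid_word_rcons u y r : braid_word (rcons u y) r =
  lext (fun z => lext (fun t => << (t.1, rcons t.2 z.2) >>) (braid_word u z.1))
      (braid_letter y r).
Proof.
elim: u => [|x u IH] /=.
  by rewrite lext_mon; apply: eq_lext => z _; rewrite lext_mon.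
rewrite IH lext_lext; apply: eq_lext => z _.
rewrite !lext_lext; apply: eq_lext => t _; rewrite !lext_mon !lext_lext.
by apply: eq_lext => t' _; rewrite lext_mon.
Qed.

Lemma braid_letter_size x r :
  supp (fun z => size z.1 = size r) (braid_letter x r).
Proof.
elim: r x => [|y r IH] x /=; first exact: supp_mon.
apply: (@supp_lext _ _ _ (fun _ => True)) => // yx _.
by apply: (supp_lext (IH _)) => z /= zr; apply: supp_mon; rewrite /= zr.
Qed.

Lemma braid_word_size q r :
  supp (fun z => size z.1 = size r /\ size z.2 = size q) (braid_word q r).
Proof.
elim: q => [|x q IH] /=; first exact: supp_mon.
apply: (supp_lext IH) => z [z1 z2].
by apply: (supp_lext (@braid_letter_size _ _)) => t /= tz; apply: supp_mon; rewrite /= tz z1 z2.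
Qed.

Lemma tens_id_mon n (f : T -> T) u v : size u = n ->
  tens_id n f (mon (u ++ v)) = f (mon u) * mon v.
Proof.
move=> un; rewrite /tens_id lextE lext_monT (fmonomE (u ++ v)).
by rewrite (take_size_cat _ un) (drop_size_cat _ un).
Qed.

Lemma id_tens_mon n (f : T -> T) u v : size u = n ->
  id_tens n f (mon (u ++ v)) = mon u * f (mon v).
Proof.
move=> un; rewrite /id_tens lextE lext_monT (fmonomE (u ++ v)).
by rewrite (take_size_cat _ un) (drop_size_cat _ un).
Qed.

Lemma tens_id_lext (K : choiceType) n (f : T -> T) (h : K -> T) (p : {malg k[K]}) :
  tens_id n f (lext h p) = lext (fun w : K => tens_id n f (h w)) p.
Proof. by rewrite /tens_id !lextE lext_lext; apply: eq_lext => w _; rewrite lextE. Qed.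

Lemma id_tens_lext (K : choiceType) n (f : T -> T) (h : K -> T) (p : {malg k[K]}) :
  id_tens n f (lext h p) = lext (fun w : K => id_tens n f (h w)) p.
Proof. by rewrite /id_tens !lextE lext_lext; apply: eq_lext => w _; rewrite lextE. Qed.

Lemma braid1E x r s : braid1 c (size r) (mon (x :: r ++ s)) =
  lext (fun z => mon (z.1 ++ z.2 :: s)) (braid_letter x r).
Proof.
elim: r x => [|y r IH] x /=; first by rewrite lext_mon.
rewrite (@tens_id_mon 2 (on_deg2 c) [:: x; y] (r ++ s) (erefl _)).
rewrite /on_deg2 lextE lext_monT /= lextE lext_mulr id_tens_lext lext_lext.
apply: eq_lext => yx _.
rewrite monM -[[:: yx.1; yx.2] ++ _]/([:: yx.1] ++ (yx.2 :: r ++ s)).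
rewrite (@id_tens_mon 1 (braid1 c (size r)) [:: yx.1] _ (erefl _)).
rewrite IH lext_mull lext_lext; apply: eq_lext => z _.
by rewrite monM lext_mon.
Qed.

Lemma braidE u v : braid c (size u) (size v) (mon (u ++ v)) =
  lext (fun z => mon (z.1 ++ z.2)) (braid_word u v).
Proof.
elim/last_ind: u v => [|u y IH] v; first by rewrite /= lext_mon /= cats0.
rewrite size_rcons /= cat_rcons (@id_tens_mon _ _ u (y :: v) (erefl _)).
have -> : mon (y :: v) = mon (y :: v ++ [::]) by rewrite cats0.
rewrite braid1E braid_word_rcons lext_mull tens_id_lext lext_lext.
apply: eq_lext => z /braid_letter_size zv.
rewrite monM catA.
have uz : size (u ++ z.1) = (size u + size v)%N by rewrite size_cat zv.
rewrite (tens_id_mon _ _ uz).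
rewrite -zv IH lext_mulr lext_lext; apply: eq_lext => t _.
by rewrite monM lext_mon /= -cats1 catA.
Qed.

(** Braiding preserves the lengths of the two factors, so cutting the concatenated result at
    [size v] recovers them. *)
Lemma tbraidE u v :
  tbraid c (mon2 u v) = lext (fun z => mon2 z.1 z.2) (braid_word u v).
Proof.
rewrite /tbraid lextE lext_mon2 /= lextE braidE lext_lext.
apply: eq_lext => z /braid_word_size[z1 _].
by rewrite lext_monT /= (take_size_cat _ z1) (drop_size_cat _ z1) tens_mon.
Qed.

Lemma bprod_mon2 p q r s : bprod (mon2 p q) (mon2 r s) =
  lext (fun z => mon2 (p ++ z.1) (z.2 ++ s)) (braid_word q r).
Proof.
rewrite bprod.unlock /bmul lextE lext_mon2 lextE lext_mon2 lextE /=.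
rewrite tens_mon tbraidE lext_lext; apply: eq_lext => z _.
by rewrite lext_mon2 /= !monM tens_mon.
Qed.

Lemma bprod_basis a b : bprod a b =
  lext (fun u : {fmonom X} * {fmonom X} => lext (fun v : {fmonom X} * {fmonom X} =>
    bprod (mon2 u.1 u.2) (mon2 v.1 v.2)) b) a.
Proof.
rewrite [in LHS]bprod.unlock /bmul lextE; apply: eq_lext => u _.
rewrite [in LHS]lextE; apply: eq_lext => v _.
rewrite [in LHS]lextE !mon_val tens_mon tbraidE bprod_mon2 lext_lext.
apply: eq_lext => z _.
by rewrite lext_mon2 /= !monM tens_mon.
Qed.

Lemma bprod_linl (K : choiceType) (h : K -> TT) (p : {malg k[K]}) b :
  bprod (lext h p) b = lext (fun w => bprod (h w) b) p.
Proof.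
by rewrite bprod_basis lext_lext; apply: eq_lext => w _; rewrite [RHS]bprod_basis.
Qed.

Lemma bprod_linr (K : choiceType) (h : K -> TT) (p : {malg k[K]}) a :
  bprod a (lext h p) = lext (fun w => bprod a (h w)) p.
Proof.
under [RHS]eq_lext => w _ do rewrite bprod_basis.
rewrite bprod_basis [RHS]lext_swap; apply: eq_lext => u _.
by rewrite lext_lext.
Qed.

Lemma bprodDl a a' b : bprod (a + a') b = bprod a b + bprod a' b.
Proof. by rewrite bprod_basis linearD /= -!bprod_basis. Qed.

Lemma bprodDr a b b' : bprod a (b + b') = bprod a b + bprod a b'.
Proof.
rewrite !(bprod_basis a) -lext_addf; apply: eq_lext => u _.
by rewrite linearD.
Qed.

Lemma bprod_mon2l p r s : bprod (mon2 p [::]) (mon2 r s) = mon2 (p ++ r) s.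
Proof. by rewrite bprod_mon2 /= lext_mon. Qed.

(** On both sides [q] moves through [r], and [x] moves through [p] and then through the image of
    [r]; [braid_letter_cat] splits the move of [x]. *)
Lemma bprod_letter_assoc x p q r s :
  bprod (mon2 [::] [:: x]) (bprod (mon2 p q) (mon2 r s)) =
  bprod (bprod (mon2 [::] [:: x]) (mon2 p q)) (mon2 r s).
Proof.
rewrite !bprod_mon2 braid_word1 lext_lext bprod_linr bprod_linl.
have L z : bprod (mon2 [::] [:: x]) (mon2 (p ++ z.1) (z.2 ++ s)) =
    lext (fun t => lext (fun t' => mon2 (t.1 ++ t'.1) (t'.2 :: z.2 ++ s))
      (braid_letter t.2 z.1)) (braid_letter x p).
  rewrite bprod_mon2 braid_word1 braid_letter_cat lext_lext lext_lext.
  apply: eq_lext => t _; rewrite lext_lext.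
  by apply: eq_lext => t' _; rewrite !lext_mon.
under eq_lext => z _ do rewrite L.
rewrite lext_swap; apply: eq_lext => t _; rewrite lext_mon bprod_mon2 /= lext_lext.
apply: eq_lext => z _; rewrite lext_lext; apply: eq_lext => t' _.
by rewrite lext_mon.
Qed.

Lemma cop_linear : linear cop.
Proof. by move=> e a b; rewrite cop.unlock /coprod !lextE linearP. Qed.

HB.instance Definition _ := GRing.isLinear.Build k T TT *:%R cop cop_linear.

Lemma cop_cons x u : cop (mon (x :: u)) =
  bprod (mon2 [::] [:: x] + mon2 [:: x] [::]) (cop (mon u)).
Proof.
have e1 : mon2 [::] [:: x] = tens (1 : T) (mon [:: x]) by rewrite -mon0 tens_mon.
have e2 : mon2 [:: x] [::] = tens (mon [:: x]) (1 : T) by rewrite -mon0 tens_mon.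
by rewrite e1 e2 cop.unlock bprod.unlock /coprod !lextE !lext_monT.
Qed.

Lemma cop1 : cop 1 = mon2 [::] [::].
Proof. by rewrite cop.unlock -mon0 /coprod lextE lext_monT /= -mon0 tens_mon. Qed.

Lemma bprod_prim_assoc x a b :
  let dx := mon2 [::] [:: x] + mon2 [:: x] [::] in
  bprod dx (bprod a b) = bprod (bprod dx a) b.
Proof.
move=> dx; rewrite -[a]lext_id.
rewrite !(bprod_linl, bprod_linr); apply: eq_lext => u _.
rewrite -[b]lext_id !bprod_linr; apply: eq_lext => v _.
rewrite !mon2_val /dx !bprodDl bprod_letter_assoc; congr (_ + _).
rewrite bprod_mon2l !bprod_mon2 bprod_linr; apply: eq_lext => z _.
by rewrite bprod_mon2l catA.
Qed.

Lemma bprod1 a : bprod (mon2 [::] [::]) a = a.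
Proof.
rewrite -[a]lext_id bprod_linr; apply: eq_lext => u _.
by rewrite mon2_val bprod_mon2l.
Qed.

(** [coprod] multiplies the primitive elements [1 (x) x + x (x) 1] from the left, so induction on
    the left word reduces the claim to associativity with such a first factor. *)
Lemma copM (a b : T) : cop (a * b) = bprod (cop a) (cop b).
Proof.
rewrite mulTE linear_lextE -[in RHS](lext_id a) linear_lextE bprod_linl.
apply: eq_lext => u _.
rewrite linear_lextE -[in RHS](lext_id b) linear_lextE bprod_linr.
apply: eq_lext => v _; rewrite !mon_val.
case: u => u; elim: u => [|x u IH] /=.
  by rewrite mon0 cop1 bprod1.
by rewrite [LHS]cop_cons IH bprod_prim_assoc cop_cons.
Qed.

End BraidedTensorProduct.

(** * Supports and leading words in [T(V)] and [T(V) (x) T(V)] *)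

Section Supports.
Variables (k : fieldType) (d : Order.disp_t) (X : finOrderType d).

Local Notation T := 'T[k, X].
Local Notation TT := 'TT[k, X].
Local Notation mon := (@mon k d X).
Implicit Types (u v p q r s : seq X) (x y : X).

Lemma suppT_mon (P : seq X -> Prop) u : P u -> suppT P (mon u).
Proof. by move=> Pu; apply: (@supp_mon _ _ _ (FMonom u)). Qed.

Lemma suppTT_mon2 (P : seq X -> seq X -> Prop) u v :
  P u v -> suppTT P (mon2 k u v).
Proof. by move=> Puv; rewrite mon2.unlock; apply: supp_mon. Qed.

Lemma suppT_lext (K : choiceType) (P : K -> Prop) (Q : seq X -> Prop)
    (h : K -> T) (a : {malg k[K]}) :
  supp P a -> (forall w, P w -> suppT Q (h w)) -> suppT Q (lext h a).
Proof. exact: supp_lext. Qed.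

Lemma suppTT_lext (K : choiceType) (P : K -> Prop) (Q : seq X -> seq X -> Prop)
    (h : K -> TT) (a : {malg k[K]}) :
  supp P a -> (forall w, P w -> suppTT Q (h w)) -> suppTT Q (lext h a).
Proof. exact: supp_lext. Qed.

Lemma suppT_sub (P Q : seq X -> Prop) (a : T) :
  (forall u, P u -> Q u) -> suppT P a -> suppT Q a.
Proof. by move=> PQ; apply: supp_sub => w; apply: PQ. Qed.

Lemma suppTT_sub (P Q : seq X -> seq X -> Prop) (a : TT) :
  (forall u v, P u v -> Q u v) -> suppTT P a -> suppTT Q a.
Proof. by move=> PQ; apply: supp_sub => w; apply: PQ. Qed.

Lemma suppTD (P : seq X -> Prop) (a b : T) :
  suppT P a -> suppT P b -> suppT P (a + b).
Proof. exact: suppD. Qed.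

Lemma suppTB (P : seq X -> Prop) (a b : T) :
  suppT P a -> suppT P b -> suppT P (a - b).
Proof. exact: suppB. Qed.

Lemma suppTZ (P : seq X -> Prop) (e : k) (a : T) : suppT P a -> suppT P (e *: a).
Proof. exact: suppZ. Qed.

Lemma suppTTD (P : seq X -> seq X -> Prop) (a b : TT) :
  suppTT P a -> suppTT P b -> suppTT P (a + b).
Proof. exact: suppD. Qed.

Lemma suppTTB (P : seq X -> seq X -> Prop) (a b : TT) :
  suppTT P a -> suppTT P b -> suppTT P (a - b).
Proof. exact: suppB. Qed.

Lemma suppTTZ (P : seq X -> seq X -> Prop) (e : k) (a : TT) :
  suppTT P a -> suppTT P (e *: a).
Proof. exact: suppZ. Qed.

Lemma suppT_subl (P : seq X -> Prop) (a b : T) :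
  suppT P (a - b) -> suppT P b -> suppT P a.
Proof. exact: supp_subl. Qed.

Lemma suppTT_subl (P : seq X -> seq X -> Prop) (a b : TT) :
  suppTT P (a - b) -> suppTT P b -> suppTT P a.
Proof. exact: supp_subl. Qed.

Lemma suppT_mul (P Q R : seq X -> Prop) (a b : T) :
  suppT P a -> suppT Q b -> (forall u v, P u -> Q v -> R (u ++ v)) ->
  suppT R (a * b).
Proof.
move=> Pa Qb PQR; rewrite mulTE; apply: suppT_lext Pa _ => u Pu.
by apply: suppT_lext Qb _ => v Qv; apply: suppT_mon; apply: PQR.
Qed.

Definition tensl (a : T) : TT := lext (fun u : {fmonom X} => mon2 k u [::]) a.
Definition tensr (a : T) : TT := lext (fun u : {fmonom X} => mon2 k [::] u) a.

Lemma tensE (a b : T) : tens a b =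
  lext (fun u : {fmonom X} => lext (fun v : {fmonom X} => mon2 k u v) b) a.
Proof.
rewrite /tens lextE; apply: eq_lext => u _; rewrite lextE; apply: eq_lext => v _.
by rewrite mon2.unlock !fmonomK.
Qed.

Lemma suppT_tensl P (a : T) (R : seq X -> seq X -> Prop) :
  suppT P a -> (forall u, P u -> R u [::]) -> suppTT R (tensl a).
Proof. by move=> Pa PR; apply: suppTT_lext Pa _ => u Pu; apply: suppTT_mon2; apply: PR. Qed.

Lemma suppT_tensr P (a : T) (R : seq X -> seq X -> Prop) :
  suppT P a -> (forall u, P u -> R [::] u) -> suppTT R (tensr a).
Proof. by move=> Pa PR; apply: suppTT_lext Pa _ => u Pu; apply: suppTT_mon2; apply: PR. Qed.

Lemma suppT_tens P Q (a b : T) (R : seq X -> seq X -> Prop) :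
  suppT P a -> suppT Q b -> (forall u v, P u -> Q v -> R u v) ->
  suppTT R (tens a b).
Proof.
move=> Pa Qb PQ; rewrite tensE; apply: suppTT_lext Pa _ => u Pu.
by apply: suppTT_lext Qb _ => v Qv; apply: suppTT_mon2; apply: PQ.
Qed.

(* [R] will be either equality of lengths or equality up to permutation. *)
Definition lead (R : rel (seq X)) u (a : T) : Prop :=
  suppT (fun w => R w u /\ dom u w) (a - mon u).

Section Lead.
Variable R : rel (seq X).
Hypothesis R_refl : reflexive R.
Hypothesis R_cat : forall u u' v v', R u u' -> R v v' -> R (u ++ v) (u' ++ v').

Lemma lead_rest u a :
  lead R u a -> suppT (fun w => R w u /\ dom u w) (a - mon u).
Proof. by []. Qed.

Lemma lead_sub u a (Q : seq X -> Prop) : lead R u a ->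
  (forall w, R w u -> dom u w -> Q w) -> suppT Q (a - mon u).
Proof. by rewrite /lead => la RQ; apply: suppT_sub la => w [? ?]; apply: RQ. Qed.

Lemma lead_supp u a : lead R u a -> suppT (fun w => R w u /\ (w = u \/ dom u w)) a.
Proof.
move=> la; apply: (@suppT_subl _ _ (mon u)).
  by apply: lead_sub la _ => w ? ?; split => //; right.
by apply: suppT_mon; split => //; left.
Qed.

(** Write [a b - u v = (a - u) b + u (b - v)]: in the first summand the dominance sits in the left
    word and persists, in the second the common prefix [u] cancels. *)
Lemma lead_mul u v a b : lead R u a -> lead R v b -> lead R (u ++ v) (a * b).
Proof.
move=> la lb; rewrite /lead.
have -> : a * b - mon (u ++ v) = (a - mon u) * b + mon u * (b - mon v).
  by rewrite -monM mulrBl mulrBr addrA subrK.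
apply: suppTD.
  apply: suppT_mul (lead_rest la) (lead_supp lb) _ => w w' [? ?] [? _].
  by split; [apply: R_cat|apply: dom_cat].
have um : suppT (fun w => w = u) (mon u) by apply: suppT_mon.
apply: suppT_mul um (lead_rest lb) _ => _ w -> [? ?]; rewrite dom_cat2l.
by split => //; apply: R_cat.
Qed.

Lemma lead_mon u : lead R u (mon u).
Proof. by rewrite /lead subrr; apply: supp0. Qed.

Lemma lead_prod (h : seq X -> T) (f : seq (seq X)) :
  (forall l, l \in f -> lead R l (h l)) ->
  lead R (flatten f) (\prod_(l <- f) h l).
Proof.
elim: f => [|l f IH] H.
  by rewrite big_nil -mon0; apply: lead_mon.
rewrite big_cons /=; apply: lead_mul => //; first exact: H (mem_head _ _).
by apply: IH => m mf; apply: H; rewrite inE mf orbT.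
Qed.

End Lead.
End Supports.

(** * Triangularity of the braiding on words *)

Section Triangular.
Variables (k : fieldType) (d : Order.disp_t) (X : finOrderType d).

Local Notation VV := 'VV[k, X].
Local Notation T := 'T[k, X].
Local Notation TT := 'TT[k, X].
Local Notation mon2 := (@mon2 k d X).
Implicit Types (u v p q r s l : seq X) (x y : X).

Variable c : VV -> VV.
Variable gamma : X -> X -> k.
Hypothesis c_tri : forall x y,
  supp (fun zt => (y < zt.1)%O) (c << (x, y) >> - gamma x y *: << (y, x) >>).

(** The scalar by which the diagonal braiding with matrix [gamma] moves [q] past [r]. *)
Definition gam q r : k := \prod_(x <- q) \prod_(y <- r) gamma x y.

Lemma gam_perm q q' r r' : perm_eq q q' -> perm_eq r r' -> gam q r = gam q' r'.
Proof.
move=> qq rr; rewrite /gam (perm_big _ qq); apply: eq_bigr => x _.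
exact: perm_big.
Qed.

(** The first letter of [r] either becomes larger, which settles dominance whatever follows, or it
    stays with coefficient [gamma x y] and the same letter [x] goes on to the rest of [r]. *)
Lemma braid_letter_tri x r :
  supp (fun z => size z.1 = size r /\ dom r z.1)
    (braid_letter c x r - (\prod_(y <- r) gamma x y) *: << (r, x) >>).
Proof.
elim: r => [|y r IH] /=; first by rewrite big_nil scale1r subrr; apply: supp0.
pose cons_map y : seq X * X -> {malg k[(seq X * X)%type]} :=
  fun rx => << (y :: rx.1, rx.2) >>.
set F := fun yx : X * X => lext _ _.
have -> : c << (x, y) >> = gamma x y *: << (y, x) >>
    + (c << (x, y) >> - gamma x y *: << (y, x) >>) by rewrite addrC subrK.
rewrite linearD linearZ /= lext_mon addrAC; apply: suppD; last first.
  apply: supp_lext (@c_tri x y) _ => zt /= yz.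
  apply: supp_lext (@braid_letter_size _ _ _ c zt.2 r) _ => t tr.
  by apply: supp_mon; rewrite /= tr yz.
rewrite big_cons -scalerA -scalerBr; apply: suppZ.
have -> : F (y, x) - (\prod_(z <- r) gamma x z) *: << (y :: r, x) >> =
    lext (cons_map y) (braid_letter c x r - (\prod_(z <- r) gamma x z) *: << (r, x) >>).
  by rewrite [in RHS]linearB [in RHS]linearZ /= lext_mon.
apply: supp_lext IH _ => t [tr dt]; apply: supp_mon => /=.
by rewrite tr dt eqxx orbT.
Qed.

(** Each further letter of [q] keeps or raises the word it passes, so remainder terms stay remainder
    terms. *)
Lemma braid_word_tri q r :
  supp (fun z => [/\ size z.1 = size r, size z.2 = size q & dom r z.1])
    (braid_word c q r - gam q r *: << (r, q) >>).
Proof.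
elim: q => [|x q IH] /=; first by rewrite /gam big_nil scale1r subrr; apply: supp0.
pose add_letter (z : seq X) : seq X * X -> {malg k[(seq X * seq X)%type]} :=
  fun rx => << (rx.1, rx.2 :: z) >>.
set F := fun rq : seq X * seq X => lext _ _.
have -> : braid_word c q r = gam q r *: << (r, q) >>
    + (braid_word c q r - gam q r *: << (r, q) >>) by rewrite addrC subrK.
rewrite linearD linearZ /= lext_mon addrAC; apply: suppD; last first.
  apply: supp_lext IH _ => -[r' q'] /= [r's q's dr'].
  have sz : supp (fun z => size z.1 = size r' /\ (z.1 = r' \/ dom r' z.1)) (braid_letter c x r').
    apply: supp_subl.
      by apply: supp_sub (@braid_letter_tri x r') => z [? ?]; split => //; right.
    by apply: suppZ; apply: supp_mon; split => //; left.
  apply: supp_lext sz _ => z /= [zs zr]; apply: supp_mon => /=.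
  rewrite zs r's q's; split => //; case: zr => [->//|]; exact: dom_trans.
rewrite {2}/gam big_cons mulrC -scalerA -/(gam q r) -scalerBr; apply: suppZ.
have -> : F (r, q) - (\prod_(z <- r) gamma x z) *: << (r, x :: q) >> =
    lext (add_letter q) (braid_letter c x r - (\prod_(z <- r) gamma x z) *: << (r, x) >>).
  by rewrite [in RHS]linearB [in RHS]linearZ /= lext_mon.
by apply: supp_lext (@braid_letter_tri x r) _ => t [tr dt]; apply: supp_mon; rewrite /= tr.
Qed.

Lemma braid_word_supp q r :
  supp (fun z => [/\ size z.1 = size r, size z.2 = size q & z.1 = r \/ dom r z.1])
    (braid_word c q r).
Proof.
apply: supp_subl.
  by apply: supp_sub (@braid_word_tri q r) => z [? ? ?]; split => //; right.
by apply: suppZ; apply: supp_mon; split => //; left.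
Qed.

Lemma bprod_tri p q r s (R : seq X -> seq X -> Prop) :
  (forall z t, size z = size r -> size t = size q -> dom r z ->
     R (p ++ z) (t ++ s)) ->
  suppTT R (bprod c (mon2 p q) (mon2 r s) - gam q r *: mon2 (p ++ r) (q ++ s)).
Proof.
move=> H; rewrite bprod_mon2.
have -> : mon2 (p ++ r) (q ++ s) = lext (fun z => mon2 (p ++ z.1) (z.2 ++ s)) << (r, q) >>.
  by rewrite lext_mon.
rewrite -linearZ -linearB; apply: suppTT_lext (@braid_word_tri q r) _ => z [? ? ?].
by apply: suppTT_mon2; apply: H.
Qed.

Lemma supp_bprod (P Q R : seq X -> seq X -> Prop) (a b : TT) :
  suppTT P a -> suppTT Q b ->
  (forall p q r s z t, P p q -> Q r s -> size z = size r -> size t = size q ->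
     (z = r \/ dom r z) -> R (p ++ z) (t ++ s)) ->
  suppTT R (bprod c a b).
Proof.
move=> Pa Qb PQR; rewrite bprod_basis; apply: suppTT_lext Pa _ => -[p q] /= Ppq.
apply: suppTT_lext Qb _ => -[r s] /= Qrs; rewrite bprod_mon2.
apply: suppTT_lext (@braid_word_supp q r) _ => z [zs zt zr].
by apply: suppTT_mon2; apply: (PQR _ _ _ _ _ _ Ppq Qrs).
Qed.

Lemma braid_word0 q : braid_word c q [::] = << ([::], q) >>.
Proof. by elim: q => //= x q ->; rewrite lext_mon /= lext_mon. Qed.

Lemma bprod_tensll (a b : T) : bprod c (tensl a) (tensl b) = tensl (a * b).
Proof.
rewrite /tensl bprod_linl mulTE lext_lext; apply: eq_lext => u _.
by rewrite bprod_linr lext_lext; apply: eq_lext => v _; rewrite bprod_mon2l lext_mon.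
Qed.

Lemma bprod_tensrr (a b : T) : bprod c (tensr a) (tensr b) = tensr (a * b).
Proof.
rewrite /tensr bprod_linl mulTE lext_lext; apply: eq_lext => u _.
rewrite bprod_linr lext_lext; apply: eq_lext => v _.
by rewrite bprod_mon2 braid_word0 !lext_mon.
Qed.

Lemma bprod_tenslr (a b : T) : bprod c (tensl a) (tensr b) = tens a b.
Proof.
rewrite /tensl /tensr bprod_linl tensE; apply: eq_lext => u _.
by rewrite bprod_linr; apply: eq_lext => v _; rewrite bprod_mon2l cats0.
Qed.

(** The scalar [gam] depends only on the letters with multiplicity, so all terms of [a] and [b] are
    moved with the same leading scalar. This is why the Lyndon elements are tracked up to
    permutation and not just by length. *)
Lemma bprod_tensrl u v (a b : T) (R : seq X -> seq X -> Prop) :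
  suppT (fun w => perm_eq w u) a ->
  suppT (fun w => perm_eq w v /\ (w = v \/ dom v w)) b ->
  (forall z t, size z = size v -> size t = size u -> dom v z -> R z t) ->
  suppTT R (bprod c (tensr a) (tensl b) - gam u v *: tens b a).
Proof.
move=> sa sb H.
have -> : tens b a = lext (fun q : {fmonom X} =>
    lext (fun r : {fmonom X} => mon2 r q) b) a by rewrite tensE lext_swap.
rewrite /tensr /tensl bprod_linl -lext_scalef -lext_oppf -lext_addf.
apply: suppTT_lext sa _ => q /= qu.
rewrite bprod_linr -lext_scalef -lext_oppf -lext_addf.
apply: suppTT_lext sb _ => r /= [rv rv'].
rewrite -(gam_perm qu rv); have := @bprod_tri [::] q r [::] R.
rewrite cats0 /=; apply => z t zr tq dz; rewrite cats0; apply: H.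
- by rewrite zr (perm_size rv).
- by rewrite tq (perm_size qu).
by case: rv' dz => [->//|]; apply: dom_trans.
Qed.

Hypothesis gamma_neq0 : forall x y, gamma x y != 0.

Lemma gam_neq0 q r : gam q r != 0.
Proof.
rewrite /gam; elim/big_ind: _ => [|a b a0 b0|x _]; rewrite ?oner_eq0 ?mulf_neq0 //.
by elim/big_ind: _ => [|a b a0 b0|y _]; rewrite ?oner_eq0 ?mulf_neq0.
Qed.

End Triangular.

(** * Lyndon elements *)

Section LyndonElements.
Variables (k : fieldType) (d : Order.disp_t) (X : finOrderType d).

Local Notation VV := 'VV[k, X].
Local Notation T := 'T[k, X].
Local Notation TT := 'TT[k, X].
Local Notation mon := (@mon k d X).
Implicit Types (u v w p q r s l : seq X) (a b : T).

Variable c : VV -> VV.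
Variable gamma : X -> X -> k.
Hypothesis c_tri : forall x y,
  supp (fun zt => (y < zt.1)%O) (c << (x, y) >> - gamma x y *: << (y, x) >>).
Hypothesis gamma_neq0 : forall x y, gamma x y != 0.

Local Notation bprod := (bprod c).
Local Notation cop := (cop c).
Local Notation gam := (gam gamma).
Local Notation lead := (lead (@perm_eq X)).

Lemma lead_perm_supp u a : lead u a ->
  suppT (fun w => perm_eq w u /\ (w = u \/ dom u w)) a.
Proof. by apply: lead_supp => v; apply: perm_refl. Qed.

Lemma lead_perm_mul u v a b : lead u a -> lead v b -> lead (u ++ v) (a * b).
Proof.
by apply: lead_mul => [w|w w' t t']; [apply: perm_refl|apply: perm_cat].
Qed.

(** The deviation of [a] from being primitive. *)
Definition dcop a : TT := cop a - tensl a - tensr a.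

Lemma dcop_linear : linear dcop.
Proof.
move=> e a b; rewrite /dcop /tensl /tensr !linearP /=.
by apply/malgP => z; rewrite !(mcoeffB, mcoeffD, mcoeffZ); ring.
Qed.

HB.instance Definition _ := GRing.isLinear.Build k T TT *:%R dcop dcop_linear.

Lemma copE a : cop a = dcop a + (tensl a + tensr a).
Proof. by rewrite /dcop addrA [X in X + _]addrAC !subrK. Qed.

(** The products [(a (x) 1)(b (x) 1)] and [(1 (x) a)(1 (x) b)] cancel against the primitive part of
    [a * b]. The term [a (x) b] is singled out because the bracket has to remove it. *)
Lemma dcopM a b : dcop (a * b) = tens a b + (bprod (tensr a) (tensl b)
  + (bprod (dcop a) (cop b) + bprod (tensl a) (dcop b) + bprod (tensr a) (dcop b))).
Proof.
rewrite {1}/dcop copM [cop a]copE bprodDl.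
have -> : bprod (tensl a + tensr a) (cop b) =
    (tensl (a * b) + (tens a b + bprod (tensl a) (dcop b))) +
    (tensr (a * b) + (bprod (tensr a) (tensl b) + bprod (tensr a) (dcop b))).
  rewrite bprodDl [cop b]copE !bprodDr bprod_tensll bprod_tenslr bprod_tensrr.
  congr (_ + _); first by rewrite addrC -addrA.
  by rewrite addrC -addrA addrCA.
set A := bprod _ (cop b); set B := bprod _ _; set C := bprod _ _.
set D := bprod _ _; set L := tensl _; set R := tensr _; set t := tens _ _.
have -> : A + (L + (t + B) + (R + (C + D))) = (t + (C + (A + B + D))) + (L + R).
  by apply/malgP => z; rewrite !mcoeffD; ring.
by rewrite addrA addrAC !addrK.
Qed.

Definition tail_dom l (x y : seq X) := (size x + size y = size l)%N /\ dom l x.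

Lemma dom_step u r z : dom u r -> z = r \/ dom r z -> dom u z.
Proof. by move=> ur [->//|]; apply: dom_trans. Qed.

Lemma cop_size l a : lead l a -> suppTT (tail_dom l) (dcop a) ->
  suppTT (fun x y => size x + size y = size l)%N (cop a).
Proof.
move=> la da; rewrite copE; apply: suppTTD.
  by apply: suppTT_sub da => x y [].
by apply: suppTTD; [apply: (suppT_tensl (lead_perm_supp la))|
   apply: (suppT_tensr (lead_perm_supp la))] => w [/perm_size wl _];
   rewrite wl ?addn0.
Qed.

(** The left factor of a remaining term begins with a word dominating [v], or is [v] followed by a
    word dominating [w], or is a word at or above [w], which dominates [v ++ w] by hypothesis. *)
Lemma dcop_lyndon_mul v w a b : lead v a -> lead w b -> dom (v ++ w) w ->
  suppTT (tail_dom v) (dcop a) -> suppTT (tail_dom w) (dcop b) ->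
  suppTT (tail_dom (v ++ w)) (dcop (a * b) - tens a b).
Proof.
move=> la lb dvw da db; rewrite dcopM addrAC subrr add0r.
have sa := lead_perm_supp la; have sb := lead_perm_supp lb.
have ta : suppTT (fun x y => x = [::] /\ size y = size v) (tensr a).
  by apply: suppT_tensr sa _ => u [/perm_size].
apply: suppTTD.
  have tb : suppTT (fun x y => [/\ y = [::], size x = size w & dom (v ++ w) x]) (tensl b).
    apply: suppT_tensl sb _ => u [uw wu]; split => //; first exact: perm_size.
    exact: dom_step dvw wu.
  apply: (supp_bprod c_tri) ta tb _ => // p q r s z t [-> qv] [-> rw dr] zr tq zr'.
  by split; [rewrite !size_cat /=; lia|apply: dom_step zr'].
apply: suppTTD; first apply: suppTTD.
- apply: (supp_bprod c_tri) da (cop_size lb db) _ => // p q r s z t [pq dp] rs zr tq _.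
  split; last exact: dom_cat.
  by rewrite !size_cat /=; lia.
- have tl : suppTT (fun x y => [/\ y = [::], perm_eq x v & x = v \/ dom v x]) (tensl a).
    by apply: suppT_tensl sa _ => u [].
  apply: (supp_bprod c_tri) tl db _ => // p q r s z t [-> pv pv'] [rs dr] zr tq zr'.
  split; first by have := perm_size pv; rewrite !size_cat tq /=; lia.
  case: pv' => [->|]; last exact: dom_cat.
  by rewrite dom_cat2l; apply: dom_step zr'.
apply: (supp_bprod c_tri) ta db _ => // p q r s z t [-> qv] [rs dr] zr tq zr'.
split; first by rewrite !size_cat /=; lia.
by apply: dom_step zr'; apply: dom_trans dvw dr.
Qed.

(** Moving [b] past [a] produces [gam w v] times [a (x) b], up to left factors dominating [v]. All
    other left factors dominate [v] or begin with a word at or above [w]. *)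
Lemma dcop_lyndon_mul_rev v w a b : lead v a -> lead w b -> dom (v ++ w) w ->
  suppTT (tail_dom v) (dcop a) -> suppTT (tail_dom w) (dcop b) ->
  suppTT (tail_dom (v ++ w)) (dcop (b * a) - gam w v *: tens a b).
Proof.
move=> la lb dvw da db; rewrite dcopM -addrA (addrAC (bprod (tensr b) _)).
have sa := lead_perm_supp la; have sb := lead_perm_supp lb.
have tb : suppTT (fun x y => x = [::] /\ size y = size w) (tensr b).
  by apply: suppT_tensr sb _ => u [/perm_size].
have dw u z : u = w \/ dom w u -> dom (v ++ w) (u ++ z).
  by move=> wu; apply: dom_catr; apply: dom_step wu.
apply: suppTTD.
  apply: suppT_tens sb sa _ => u u' [uw wu] [uv _].
  split; first by rewrite size_cat (perm_size uw) (perm_size uv) addnC.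
  by rewrite -[u]cats0; apply: dw.
apply: suppTTD.
  apply: (bprod_tensrl c_tri (u := w) (v := v)) => //.
    by apply: suppT_sub sb => u [].
  move=> z t zv tw dz; split; first by rewrite zv tw size_cat.
  exact: dom_catl.
apply: suppTTD; first apply: suppTTD.
- apply: (supp_bprod c_tri) db (cop_size la da) _ => // p q r s z t [pq dp] rs zr tq _.
  split; last by apply: dom_catr; apply: dom_trans dvw dp.
  by rewrite !size_cat /=; lia.
- have tl : suppTT (fun x y => [/\ y = [::], perm_eq x w & x = w \/ dom w x]) (tensl b).
    by apply: suppT_tensl sb _ => u [].
  apply: (supp_bprod c_tri) tl da _ => // p q r s z t [-> pw pw'] [rs dr] zr tq zr'.
  split; last exact: dw.
  by have := perm_size pw; rewrite !size_cat tq /=; lia.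
apply: (supp_bprod c_tri) tb da _ => // p q r s z t [-> qw] [rs dr] zr tq zr'.
split; first by rewrite !size_cat /=; lia.
by apply: dom_step zr'; apply: dom_catl.
Qed.

Lemma dcop_letter x : dcop (mon [:: x]) = 0.
Proof.
rewrite /dcop cop_cons mon0 cop1 bprodDl bprod_mon2l /tensl /tensr !lext_monT /=.
by rewrite bprod_mon2 braid_word0 lext_mon /= addrK subrr.
Qed.

(* The bracket [b_v b_w - gam w v ^-1 b_w b_v] of the diagonal braiding
   [x (x) y |-> gamma x y (y (x) x)], the leading part of [c]. *)
Lemma lyndon_elt l : exists a, lyndon l ->
  lead l a /\ suppTT (tail_dom l) (dcop a).
Proof.
have [n] := ubnP (size l); elim: n l => // n IH l ln.
(* Words that are not Lyndon get the value 0, so that a function on all words can be chosen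
   later. *)
case: (boolP (lyndon l)) => ll; last by exists 0.
case: (leqP (size l) 1) => l1.
  exists (mon l) => _; split; first exact: lead_mon.
  case: l l1 ll {ln} => [|x [|? ?]] //= _ _; rewrite dcop_letter; exact: supp0.
have [v [w [lE lv lw _]]] := shirshov_spec ll l1.
have v0 := lyndon_neq0 lv; have w0 := lyndon_neq0 lw.
have sv : (0 < size v)%N by case: (v) v0.
have sw : (0 < size w)%N by case: (w) w0.
have [|a /(_ lv) [la da]] := IH v.
  by move: ln; rewrite lE size_cat; lia.
have [|b /(_ lw) [lb db]] := IH w.
  by move: ln; rewrite lE size_cat; lia.
have dvw : dom (v ++ w) w by apply: lyndon_cat_dom => //; rewrite -lE.
exists (a * b - (gam w v)^-1 *: (b * a)) => _; split; rewrite lE.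
  rewrite /lead addrAC; apply: suppTB; first exact: lead_perm_mul.
  apply: suppTZ.
  apply: suppT_mul (lead_perm_supp lb) (lead_perm_supp la) _.
  move=> u u' [uw wu] [uv _]; split.
    by rewrite perm_catC; apply: perm_cat.
  by apply: dom_catr; apply: dom_step wu.
have -> : dcop (a * b - (gam w v)^-1 *: (b * a)) = dcop (a * b) - tens a b
    - (gam w v)^-1 *: (dcop (b * a) - gam w v *: tens a b).
  rewrite [in LHS]linearB [in LHS]linearZ /= [in RHS]scalerBr scalerA.
  rewrite mulVf ?gam_neq0 // scale1r.
  by rewrite opprB addrA subrK.
apply: suppTTB; first exact: dcop_lyndon_mul.
by apply: suppTTZ; apply: dcop_lyndon_mul_rev.
Qed.

End LyndonElements.

(** * Coproducts of products of Lyndon elements *)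

Section LyndonProducts.
Variables (k : fieldType) (d : Order.disp_t) (X : finOrderType d).

Local Notation VV := 'VV[k, X].
Local Notation T := 'T[k, X].
Local Notation TT := 'TT[k, X].
Local Notation mon := (@mon k d X).
Local Notation mon2 := (@mon2 k d X).
Implicit Types (u v w p q r s l m : seq X) (a : T).

Variable c : VV -> VV.
Variable gamma : X -> X -> k.
Hypothesis c_tri : forall x y,
  supp (fun zt => (y < zt.1)%O) (c << (x, y) >> - gamma x y *: << (y, x) >>).

Variable b : seq X -> T.
Hypothesis b_lead : forall l, lyndon l -> lead (@perm_eq X) l (b l).
Hypothesis b_dcop : forall l, lyndon l -> suppTT (tail_dom l) (dcop c (b l)).

Local Notation bprod := (bprod c).
Local Notation cop := (cop c).
Local Notation gam := (gam gamma).
Local Notation lead := (lead (@perm_eq X)).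

Lemma dom_inf_step l x y : dom_inf l x -> y = x \/ dom x y -> dom_inf l y.
Proof. by move=> [n dn] xy; exists n; apply: dom_step xy. Qed.

Lemma dom_inf_cat l x y : dom_inf l x -> dom_inf l (x ++ y).
Proof. by move=> [n dn]; exists n; apply: dom_catr. Qed.

(** As [x] has the length of [wpow l e], its comparison with the infinite power is decided within
    the first [e] copies of [l]. *)
Lemma dom_inf_wpow l e x : dom_inf l x -> size x = (e * size l)%N ->
  dom (wpow l e) x.
Proof.
move=> [n dn] sx; case: (leqP n e) => ne.
  by rewrite -(subnKC ne) wpowD; apply: dom_catl.
apply: (@dom_catl_size _ _ _ _ (wpow l (n - e))); first by rewrite size_wpow sx.
by rewrite -wpowD subnKC // ltnW.
Qed.

Definition lyndon_prod f : T := \prod_(l <- f) b l.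

Lemma lyndon_prod_lead f : all (@lyndon _ X) f ->
  lead (flatten f) (lyndon_prod f).
Proof.
move=> lf; apply: lead_prod => [w|w w' t t'|l lf'].
- exact: perm_refl.
- exact: perm_cat.
by apply: b_lead; apply: (allP lf).
Qed.

(** The first factor [b m] that contributes to the left tensor factor contributes a word at or above
    [m], which exceeds the infinite power of [l]. Moving it past the contributions of earlier
    factors can only raise it. *)
Lemma lyndon_prod_cop l f : l != [::] -> all (@lyndon _ X) f ->
  (forall m, m \in f -> lex_lt l m) ->
  suppTT (fun x y => (size x + size y = size (flatten f))%N /\ dom_inf l x)
    (cop (lyndon_prod f) - tensr (lyndon_prod f)).
Proof.
rewrite /lyndon_prod => l0; elim: f => [|m f IH] lf lm.
  by rewrite big_nil cop1 -mon0 /tensr lext_monT subrr; apply: supp0.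
move: lf; rewrite big_cons /= => /andP[lym lf].
have [lb db] := (b_lead lym, b_dcop lym).
have l_m : lex_lt l m by apply: lm; rewrite mem_head.
have dm : dom_inf l m.
  by apply: dom_inf_lyndon.
have {IH} db' := IH lf (fun m' mf => lm m' (@mem_behead _ (m :: f) m' mf)).
set p := \prod_(l <- f) b l in db' *.
have pE : cop p = (cop p - tensr p) + tensr p by rewrite subrK.
have bE : cop (b m) = (dcop c (b m) + tensl (b m)) + tensr (b m).
  by rewrite copE addrA.
set E1 := dcop c (b m) + tensl (b m) in bE.
have sE1 : suppTT (fun x y => (size x + size y = size m)%N /\ dom_inf l x) E1.
  apply: suppTTD.
    apply: suppTT_sub db => x y [xy mx]; split => //.
    by apply: dom_inf_step dm _; right.
  apply: (suppT_tensl (lead_perm_supp lb)) => u [/perm_size um mu].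
  by split; [rewrite addn0|apply: dom_inf_step dm mu].
have sr a n : suppT (fun w => size w = n) a ->
    suppTT (fun x y => x = [::] /\ size y = n) (tensr a).
  by move=> sa; apply: suppT_tensr sa _.
have sp : suppT (fun w => size w = size (flatten f)) p.
  by apply: suppT_sub (lead_perm_supp (lyndon_prod_lead lf)) => w [/perm_size].
have sb : suppT (fun w => size w = size m) (b m).
  by apply: suppT_sub (lead_perm_supp lb) => w [/perm_size].
have scp : suppTT (fun x y => size x + size y = size (flatten f))%N (cop p).
  rewrite pE; apply: suppTTD; first by apply: suppTT_sub db' => x y [].
  by apply: suppTT_sub (sr _ _ sp) => x y [-> <-].
have -> : cop (b m * p) - tensr (b m * p) =
    bprod E1 (cop p) + bprod (tensr (b m)) (cop p - tensr p).
  rewrite copM bE bprodDl {2}pE bprodDr (bprod_tensrr c) addrA addrK.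
  by [].
apply: suppTTD.
  apply: (supp_bprod c_tri) sE1 scp _ => // p1 q r s z t [pq dp] rs zr tq _.
  by split; [rewrite !size_cat /=; lia|apply: dom_inf_cat].
apply: (supp_bprod c_tri) (sr _ _ sb) db' _ => p1 q r s z t [-> qv] [rs dr] zr tq zr'.
by split; [rewrite !size_cat /=; lia|apply: dom_inf_step zr'].
Qed.

(** A letter that enters the right tensor factor leaves it nonempty for good, because braiding
    preserves lengths. *)
Lemma cop_top u : suppTT (fun x y => (size x + size y = size u)%N /\ y <> [::])
  (cop (mon u) - tensl (mon u)).
Proof.
elim: u => [|x u IH].
  by rewrite mon0 cop1 -mon0 /tensl lext_monT subrr; apply: supp0.
rewrite cop_cons bprodDl.
have uE : cop (mon u) = (cop (mon u) - tensl (mon u)) + mon2 u [::].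
  by rewrite /tensl lext_monT subrK.
have -> : bprod (mon2 [:: x] [::]) (cop (mon u)) =
    bprod (mon2 [:: x] [::]) (cop (mon u) - tensl (mon u)) + tensl (mon (x :: u)).
  by rewrite {1}uE bprodDr bprod_mon2l /tensl !lext_monT.
rewrite addrA addrK; apply: suppTTD.
  have s1 : suppTT (fun p q => p = [::] /\ q = [:: x]) (mon2 [::] [:: x]) by apply: suppTT_mon2.
  have s2 : suppTT (fun p q => size p + size q = size u)%N (cop (mon u)).
    rewrite uE; apply: suppTTD; first by apply: suppTT_sub IH => ? ? [].
    by apply: suppTT_mon2; rewrite addn0.
  apply: (supp_bprod c_tri) s1 s2 _ => p q r s z t [-> ->] rs zr tq _.
  split; first by rewrite !size_cat tq /=; lia.
  by case: t tq.
have s1 : suppTT (fun p q => p = [:: x] /\ q = [::]) (mon2 [:: x] [::]) by apply: suppTT_mon2.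
apply: (supp_bprod c_tri) s1 IH _ => p q r s z t [-> ->] [rs s0] zr tq _.
split; first by rewrite !size_cat tq /=; lia.
by case: t tq.
Qed.

Lemma cop_top_homog n a : suppT (fun w => size w = n) a ->
  suppTT (fun x y => (size x + size y = n)%N /\ y <> [::]) (cop a - tensl a).
Proof.
move=> sa; rewrite (linear_lext (cop : {linear T -> TT})) /tensl -lext_oppf -lext_addf.
apply: suppTT_lext sa _ => w <-; rewrite mon_val.
by have := @cop_top w; rewrite /tensl lext_monT.
Qed.

(* The terms not displayed are killed by, or sent to degree less than
   [size (flatten f)] by, a functional on the left factor that vanishes on the
   words larger than [wpow l e] in the standard order. *)
Lemma cop_lyndon_power l f j e : lyndon l -> all (@lyndon _ X) f ->
  (forall m, m \in f -> lex_lt l m) -> (j <= e)%N ->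
  let N := (size (flatten f) + j * size l)%N in
  suppTT (fun x y => (size x + size y = N)%N /\
      (size x = (e * size l)%N -> dom (wpow l e) x))
    (cop (lyndon_prod f * b l ^+ j) -
     (gam (flatten f) (wpow l e) *+ (j == e)) *:
       tens (mon (wpow l e)) (lyndon_prod f)).
Proof.
move=> ll lf lm je N.
have l0 : (0 < size l)%N by have := lyndon_neq0 ll; case: (l).
have l0' : l != [::] by rewrite -size_eq0 -lt0n.
have lq : lead (wpow l j) (b l ^+ j).
  elim: (j) => [|i IH]; first by rewrite expr0 -mon0; apply: lead_mon.
  by rewrite exprS wpowS; apply: lead_perm_mul (b_lead ll) IH.
have sp := lead_perm_supp (lyndon_prod_lead lf).
set p := lyndon_prod f in sp *; set q := b l ^+ j in lq *.
have dp := lyndon_prod_cop l0' lf lm; rewrite -/p in dp.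
have sq := lead_perm_supp lq.
have szq : suppT (fun w => size w = (j * size l)%N) q.
  by apply: suppT_sub sq => w [/perm_size ->]; rewrite size_wpow.
have dq := cop_top_homog szq.
have -> : cop (p * q) = bprod (cop p - tensr p) (cop q) +
    (bprod (tensr p) (cop q - tensl q) + bprod (tensr p) (tensl q)).
  by rewrite copM -bprodDr subrK -bprodDl subrK.
have sr : suppTT (fun x y => x = [::] /\ size y = size (flatten f)) (tensr p).
  by apply: suppT_tensr sp _ => w [/perm_size].
(* First the terms where [p] contributes to the left factor, which then begins above the infinite
   power of [l]. *)
rewrite -!addrA; apply: suppTTD.
  have scq : suppTT (fun x y => size x + size y = j * size l)%N (cop q).
    apply: (suppTT_subl (b := tensl q)); first by apply: suppTT_sub dq => x y [].
    by apply: suppT_tensl szq _ => w ->; rewrite addn0.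
  apply: (supp_bprod c_tri) dp scq _ => p1 q1 r s z t [pq d1] rs zr tq _.
  split; first by rewrite /N !size_cat; lia.
  by apply: dom_inf_wpow; apply: dom_inf_cat.
apply: suppTTD.
  (* A nonempty part of [q] goes to the right, so the left factor is shorter than [wpow l e]. *)
  apply: (supp_bprod c_tri) sr dq _ => p1 q1 r s z t [-> qf] [rs s0] zr tq _.
  split; first by rewrite /N !size_cat /=; lia.
  move=> /= zl; exfalso; apply: s0; apply/nilP; rewrite /nilp.
  have := leq_mul2r (size l) j e; rewrite je orbT => jel; lia.
(* For [j < e] all of [q] is still too short. For [j = e] this is the leading term, in which [q] is
   replaced by its leading word [wpow l e]. *)
case: (ltngtP j e) je => [je _|//|je _]; last first.
  have sp' : suppT (fun w => perm_eq w (flatten f)) p by apply: suppT_sub sp => w [].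
  rewrite mulr1n -je; set g := gam _ _; set u := wpow l j in lq sq g *.
  have -> : bprod (tensr p) (tensl q) - g *: tens (mon u) p =
      (bprod (tensr p) (tensl q) - g *: tens q p) + g *: tens (q - mon u) p.
    have -> : tens (q - mon u) p = tens q p - tens (mon u) p.
      by rewrite !tensE linearB.
    by rewrite scalerBr addrA subrK.
  apply: suppTTD.
    apply: (bprod_tensrl c_tri sp' sq) => z t zr tq dz; rewrite zr tq size_wpow.
    by split; first by rewrite addnC.
  apply: suppTTZ; apply: suppT_tens (lead_rest lq) sp _ => w w' [wu dw] [wf _].
  by rewrite (perm_size wu) (perm_size wf) size_wpow; split; first by rewrite addnC.
rewrite mulr0n scale0r subr0.
have sl : suppTT (fun x y => size x = (j * size l)%N /\ y = [::]) (tensl q).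
  by apply: suppT_tensl szq _.
apply: (supp_bprod c_tri) sr sl _ => p1 q1 r s z t [-> qf] [rs ->] zr tq _.
split; first by rewrite /N !size_cat /=; lia.
move=> /= zl; have := ltn_mul2r (size l) j e; rewrite je l0; lia.
Qed.

End LyndonProducts.

(** * Irreducible words *)

Section StandardOrder.
Variables (d : Order.disp_t) (X : finOrderType d).
Implicit Types (u v w a b : seq X).

Lemma std_gtE w u :
  std_gt w u = (size w < size u)%N || (size w == size u) && dom u w.
Proof.
rewrite /std_gt; case: (size w =P size u) => //= e.
by rewrite lex_lt_size.
Qed.

Lemma std_gt_dom u w : size w = size u -> dom u w -> std_gt w u.
Proof. by move=> e uw; rewrite std_gtE e eqxx uw orbT. Qed.

Lemma std_gt_trans v u w : std_gt v u -> std_gt w v -> std_gt w u.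
Proof.
rewrite !std_gtE => /orP[vu|/andP[/eqP <- uv]].
  by case/orP=> [wv|/andP[/eqP-> _]]; rewrite ?vu // (ltn_trans wv vu).
by case/orP=> [->//|/andP[-> vw]]; rewrite (dom_trans uv vw) orbT.
Qed.

Lemma std_gtxx u : std_gt u u = false.
Proof. by rewrite std_gtE ltnn eqxx domxx. Qed.

Lemma std_gt_total u v : [\/ std_gt u v, u = v | std_gt v u].
Proof.
rewrite !std_gtE; case: (ltngtP (size u) (size v)) => [||e].
- by constructor 1.
- by constructor 3.
case: (lex_lt_total u v) => [||]; last 1 first.
- by rewrite lex_lt_size // => ->; constructor 1.
- by rewrite lex_lt_size // => ->; constructor 3.
- by constructor 2.
Qed.

Lemma std_gt_cat w u a b : std_gt w u -> std_gt (a ++ w ++ b) (a ++ u ++ b).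
Proof.
rewrite !std_gtE dom_cat2l !size_cat => /orP[wu|/andP[/eqP-> uw]].
  by rewrite ltn_add2l ltn_add2r wu.
by rewrite eqxx dom_cat // orbT.
Qed.

Lemma std_min (s : seq (seq X)) : s <> [::] ->
  exists2 u, u \in s & forall v, v \in s -> v = u \/ std_gt v u.
Proof.
elim: s => // u [|w s] IH _.
  by exists u; [rewrite mem_head|move=> v; rewrite inE => /eqP; left].
have [//|m ms mmin] := IH.
case: (std_gt_total u m) => [um|->|mu].
- exists m; first by rewrite inE ms orbT.
  by move=> v; rewrite inE => /orP[/eqP->|/mmin//]; right.
- exists m; first by rewrite mem_head.
  by move=> v; rewrite inE => /orP[/eqP->|/mmin//]; left.
- exists u; first by rewrite mem_head.
  move=> v; rewrite inE => /orP[/eqP->|/mmin[->|vm]]; [by left|by right|].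
  by right; apply: std_gt_trans mu vm.
Qed.

(* The standard order is well founded since only finitely many words are
   larger than a given one. *)
Lemma std_ind (P : seq X -> Prop) :
  (forall u, (forall w, std_gt w u -> P w) -> P u) -> forall u, P u.
Proof.
move=> IH u; have [n] := ubnP (size u); elim: n u => // n IHn u un.
pose rank w := #|[pred t : (size u).-tuple X | dom w t]|.
have H m w : size w = size u -> (rank w < m)%N -> P w; last first.
  exact: (H (rank u).+1 u).
elim: m w => // m IHm w wu rw; apply: IH => v; rewrite std_gtE.
case/orP=> [vw|/andP[/eqP vw wv]].
  by apply: IHn; rewrite wu in vw; apply: leq_trans vw _.
apply: IHm; first by rewrite vw.
apply: leq_trans (rw : (rank w <= m)%N).
apply: proper_card; apply/properP; split.
  by apply/fintype.subsetP => t; rewrite !inE; apply: dom_trans.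
have vs : size v == size u by rewrite vw wu.
by exists (Tuple vs); rewrite !inE //= domxx.
Qed.

End StandardOrder.

(** * Normal forms modulo the ideal and functionals vanishing on it *)

Section Irreducible.
Variables (k : fieldType) (d : Order.disp_t) (X : finOrderType d).

Local Notation T := 'T[k, X].
Local Notation TT := 'TT[k, X].
Local Notation mon := (@mon k d X).
Implicit Types (u v w : seq X) (a b p q r : T).

Variable I : properIdeal T.

Lemma idealZ (e : k) a : ideal_set I a -> ideal_set I (e *: a).
Proof. by move=> Ia; rewrite -[a]mul1r scalerAl; apply: ideal_setMl. Qed.

Lemma idealN a : ideal_set I a -> ideal_set I (- a).
Proof. by move=> Ia; rewrite -scaleN1r; apply: idealZ. Qed.

Lemma idealB a b : ideal_set I a -> ideal_set I b -> ideal_set I (a - b).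
Proof. by move=> Ia Ib; apply: ideal_setD => //; apply: idealN. Qed.

Lemma ideal_sum (J : eqType) (s : seq J) (F : J -> T) :
  (forall i, i \in s -> ideal_set I (F i)) -> ideal_set I (\sum_(i <- s) F i).
Proof.
move=> IF; rewrite big_seq; elim/big_ind: _ => [|x y|i]; first exact: ideal_set0.
  exact: ideal_setD.
exact: IF.
Qed.

Lemma ideal1 : ~ ideal_set I 1.
Proof. by have := ideal_pred1 I; rewrite /ideal_pred => /asboolP. Qed.

Lemma span_mon (P : seq X -> Prop) p :
  Defs.span [set mon w | w in [set w | P w]] p <-> suppT P p.
Proof.
split=> [[s [e [sP ->]]]|Pp].
  apply: (@supp_sum _ _ (fun w : {fmonom X} => P w)) => x /sP[w Pw <-].
  by apply: suppZ; apply: suppT_mon.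
(* In [span] the coefficients are a function of the vector, so [w] is read back as the only element
   of the support of [<< w >>]; the empty word is just the default of [head]. *)
exists [seq << w >> | w : {fmonom X} <- msupp p],
  (fun x : T => p@_(head (FMonom [::]) (msupp x))).
split=> [x /mapP[w wp ->]|].
  by exists (w : seq X); [apply: Pp|rewrite mon_val].
rewrite big_map {1}[p]malg_basis; apply: eq_bigr => w _.
rewrite msuppU oner_eq0; suff -> : head (FMonom [::]) [fset w]%fset = w by [].
have H (x : {fmonom X}) : (x \in enum_fset [fset w]%fset) = (x == w) by exact: in_fset1.
case: (enum_fset _) H => [|x t] H; first by have := H w; rewrite eqxx.
by have := H x; rewrite mem_head => /esym/eqP.
Qed.

Lemma higherP u p : higher I u p <->
  exists2 s, suppT (fun w => std_gt w u) s & ideal_set I (p - s).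
Proof.
split=> [[s /span_mon ss] [i Ii <-]|[s ss Is]].
  by exists s => //; rewrite addrC addKr.
by exists s; [apply/span_mon|exists (p - s) => //; rewrite addrC subrK].
Qed.

Definition irreducible u : Prop := ~ higher I u (mon u).

(** An expression of [v] by larger words can be multiplied by [u] and [w]: the ideal is two-sided
    and the standard order is compatible with concatenation. *)
Lemma irreducible_sub u v w : irreducible (u ++ v ++ w) -> irreducible v.
Proof.
move=> irr /higherP[s ss Is]; apply: irr; apply/higherP.
exists (mon u * s * mon w); last first.
  by rewrite -!monM mulrA -mulrBl -mulrBr; apply: ideal_setMr; apply: ideal_setMl.
have su : suppT (fun t => t = u) (mon u) by apply: suppT_mon.
have sw : suppT (fun t => t = w) (mon w) by apply: suppT_mon.
rewrite -mulrA; apply: suppT_mul su (suppT_mul ss sw _) _ => [t t'|t t'].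
  by move=> tv ->; instantiate (1 := fun t => exists2 t', std_gt t' v & t = t' ++ w); exists t.
by move=> -> [t'' tv ->]; apply: std_gt_cat.
Qed.

Section Basis.
Variable h : seq X -> T.
Hypothesis h_lead : forall u, irreducible u ->
  suppT (fun w => std_gt w u) (h u - mon u).

(** Otherwise the smallest word in the support of [q] would be expressible modulo [I] by larger
    words. *)
Lemma irreducible_indep q : suppT irreducible q ->
  ideal_set I (lext (fun w : {fmonom X} => h w) q) -> q = 0.
Proof.
move=> irr Iq; apply: contrapT => q0.
have [|u us umin] := @std_min _ _ [seq (w : seq X) | w : {fmonom X} <- msupp q].
  move=> e; apply: q0; apply/eqP; rewrite -msupp_eq0.
  apply/eqP/fsetP => w; rewrite in_fset0; apply/negP.
  by move=> /(map_f (fun w : {fmonom X} => w : seq X)); rewrite e.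
move/mapP: us => [u' u'q uE].
have uu : u' = FMonom u by rewrite uE fmonomK.
have irru : irreducible u by rewrite uE; apply: irr.
have qu : q@_u' != 0 by rewrite mcoeff_neq0.
have sr : suppT (fun w => irreducible w /\ std_gt w u) (q - q@_u' *: mon u).
  apply/suppP => w nw; rewrite mcoeffB mcoeffZ /Defs.mon -uu mcoeffU.
  case: (u' =P w) => [<-|ne]; first by rewrite mulr1 subrr.
  rewrite mulr0 subr0; apply: mcoeff_outdom; apply/negP => wq; apply: nw.
  split; first exact: irr.
  have [|e|//] := umin (w : seq X); first by apply: map_f.
  by case: ne; rewrite -(fmonomK w) e.
apply: (irru); apply/higherP.
pose g := lext (fun w : {fmonom X} => h w).
(* The relation solved for [mon u]: the other terms and the correction [h u - mon u] involve larger
   words only. *)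
exists (- (q@_u')^-1 *: (g (q - q@_u' *: mon u) + q@_u' *: (h u - mon u))).
  apply: suppTZ; apply: suppTD; last by apply: suppTZ; apply: h_lead.
  apply: suppT_lext sr _ => w [irrw wu].
  apply: (suppT_subl (b := mon w)); last exact: suppT_mon.
  by apply: suppT_sub (h_lead irrw) => v vw; apply: std_gt_trans wu vw.
have -> : mon u - - (q@_u')^-1 *: (g (q - q@_u' *: mon u) + q@_u' *: (h u - mon u))
    = (q@_u')^-1 *: g q.
  have -> : g (q - q@_u' *: mon u) = g q - q@_u' *: h u.
    by rewrite /g linearB linearZ /= lext_monT.
  rewrite scaleNr opprK.
  rewrite [_ *: (h u - _)]scalerBr addrA subrK.
  by rewrite scalerBr scalerA mulVf // scale1r addrC subrK.
exact: idealZ.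
Qed.

(** By induction from the larger words: an irreducible [w] is [h w] up to larger words, any other
    [w] is congruent to a combination of larger words. *)
Lemma irreducible_gen w : exists q,
  suppT (fun v => irreducible v /\ (v = w \/ std_gt v w)) q /\
  ideal_set I (mon w - lext (fun v : {fmonom X} => h v) q).
Proof.
elim/std_ind: w => w IH.
pose g := lext (fun v : {fmonom X} => h v).
pose R a b := suppT (fun v => irreducible v /\ (v = w \/ std_gt v w)) b
  /\ ideal_set I (a - g b).
have R0 : R 0 0.
  by split; [exact: supp0|rewrite /g (raddf0 (lext _)) subr0; apply: ideal_set0].
have RL e a b a' b' : R a b -> R a' b' -> R (e *: a + a') (e *: b + b').
  move=> [sb Iab] [sb' Iab']; split; first by apply: suppTD => //; apply: suppTZ.
  rewrite /g linearP /= -/g opprD addrACA -scalerBr.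
  by apply: ideal_setD => //; apply: idealZ.
have RI v : std_gt v w -> exists q, R (mon v) q.
  move=> vw; have [q [sq Iq]] := IH v vw; exists q; split => //.
  apply: suppT_sub sq => t [irrt tv]; split => //; right.
  by case: tv => [->//|]; apply: std_gt_trans.
have RI' (v : {fmonom X}) : std_gt v w -> exists q, R << v >> q.
  by rewrite mon_val; apply: RI.
have lift a := @basis_lift _ _ _ R _ a R0 RL RI'.
case: (pselect (irreducible w)) => irrw.
  have [q [sq Iq]] := lift _ (h_lead irrw).
  exists (mon w - q); split.
    by apply: suppTB => //; apply: suppT_mon; split => //; left.
  rewrite -/g; have -> : g (mon w - q) = h w - g q by rewrite /g linearB /= lext_monT.
  have -> : mon w - (h w - g q) = - (h w - mon w - g q).
    by rewrite !opprB addrCA.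
  exact: idealN.
have /higherP[s ss Is] : higher I w (mon w) by apply: contrapT.
have [q [sq Iq]] := lift _ ss; exists q; split => //.
by rewrite -[mon w](subrK s) -addrA; apply: ideal_setD.
Qed.

End Basis.

(** The value of [g] at a word is the coefficient of [u] in its normal form, the expansion into
    irreducible words modulo [I]. Normal forms only involve the word itself and larger ones, which
    gives the first two properties. *)
Lemma functional u : irreducible u -> exists g : seq X -> k,
  [/\ g u = 1, forall w, std_gt w u -> g w = 0 &
      forall a, ideal_set I a ->
        lext (fun w : {fmonom X} => g w : k^o) a = 0].
Proof.
move=> irru.
have mon_lead v : irreducible v -> suppT (fun w => std_gt w v) (mon v - mon v).
  by rewrite subrr => _; apply: supp0.
have [nf nfP] := choice (irreducible_gen mon_lead).
have lmon a : lext (fun v : {fmonom X} => mon v) a = a.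
  by rewrite -[RHS]lext_id; apply: eq_lext => w _; rewrite mon_val.
have indep a : suppT irreducible a -> ideal_set I a -> a = 0.
  by move=> sa Ia; apply: (irreducible_indep mon_lead sa); rewrite lmon.
exists (fun w => (nf w)@_(FMonom u)); split.
- have [sn In] := nfP u; rewrite lmon in In.
  have /eqP : mon u - nf u = 0.
    apply: indep In; apply: suppTB; first exact: suppT_mon.
    by apply: suppT_sub sn => v [].
  by rewrite subr_eq0 => /eqP <-; rewrite mcoeffUU.
- move=> w wu; have [sn _] := nfP w.
  apply: mcoeff_outdom; apply/negP => /sn /= [_ [uw|uw]].
    by rewrite -uw std_gtxx in wu.
  by have := std_gt_trans wu uw; rewrite std_gtxx.
move=> a Ia.
have E : (lext (fun w : {fmonom X} => nf w) a)@_(FMonom u) =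
    lext (fun w : {fmonom X} => (nf w)@_(FMonom u) : k^o) a.
  by rewrite lext.unlock raddf_sum; apply: eq_bigr => w _; rewrite /= mcoeffZ.
rewrite -E; suff -> : lext (fun w : {fmonom X} => nf w) a = 0 by rewrite mcoeff0.
apply: indep.
  apply: (@suppT_lext _ _ _ _ (fun _ => True)) => // w _.
  by have [sn _] := nfP w; apply: suppT_sub sn => v [].
rewrite -[X in ideal_set I X](subKr a); apply: idealB => //.
rewrite -{1}[a]lmon -lext_oppf -lext_addf lext.unlock; apply: ideal_sum => w _.
by apply: idealZ; have [_] := nfP w; rewrite lmon.
Qed.

(** The map [g (x) id]. *)
Definition contract (g : seq X -> k) (z : TT) : T :=
  lext (fun z : {fmonom X} * {fmonom X} => g z.1 *: mon z.2) z.

Lemma contract_linear g : linear (contract g).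
Proof. by move=> e a b; rewrite /contract linearP. Qed.

HB.instance Definition _ g :=
  GRing.isLinear.Build k TT T *:%R (contract g) (contract_linear g).

Lemma contract_tens g a b : contract g (tens a b) =
  lext (fun w : {fmonom X} => g w : k^o) a *: b.
Proof.
have -> : lext (fun w : {fmonom X} => g w : k^o) a *: b =
    lext (fun w : {fmonom X} => g w *: b) a.
  by rewrite lext.unlock scaler_suml; apply: eq_bigr => u _; rewrite -scalerA.
rewrite tensE /contract lext_lext; apply: eq_lext => u _.
rewrite lext_lext -[in RHS](lext_id b) -lext_scalef; apply: eq_lext => v _.
by rewrite lext_mon2 mon_val.
Qed.

(** On [I (x) T] the functional vanishes; on [T (x) I] the result is a multiple of the right
    factor. *)
Lemma contract_ideal (g : seq X -> k) z :
  (forall a, ideal_set I a -> lext (fun w : {fmonom X} => g w : k^o) a = 0) ->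
  set_add (tens_sub I setT) (tens_sub setT I) z -> ideal_set I (contract g z).
Proof.
move=> gI [x [s [e [sI ->]]] [y [s' [e' [sI' ->]]] <-]].
rewrite linearD; apply: ideal_setD; rewrite (linear_sum (contract g)); apply: ideal_sum => t ts.
  have [a Ia [b _ <-]] := sI t ts.
  rewrite linearZ /= contract_tens gI // scale0r scaler0; exact: ideal_set0.
have [a _ [b Ib <-]] := sI' t ts.
by rewrite linearZ /= contract_tens; do 2!apply: idealZ.
Qed.

End Irreducible.

(** * PBW words are irreducible *)

Section SortedFactors.
Variables (d : Order.disp_t) (X : finOrderType d).
Implicit Types (u v w l m : seq X) (f : seq (seq X)).

Lemma sorted_split l f : sorted (@lex_ge _ X) f -> exists f1 f2,
  [/\ f = f1 ++ nseq (count_mem l f) l ++ f2,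
      forall m, m \in f1 -> lex_lt l m & forall m, m \in f2 -> lex_lt m l].
Proof.
elim: f => [|m f IH]; first by exists [::], [::].
rewrite sorted_cons_ge => /andP[/allP mf /IH [f1 [f2 [fE H1 H2]]]].
have f1_0 : lex_lt l m = false -> f1 = [::].
  case: f1 fE H1 {H2} => // m' f1 fE H1 /negbT lm; have := H1 m' (mem_head _ _).
  have := mf m'; rewrite {1}fE mem_head lex_geE => /(_ isT) mm' lm'.
  case: (lex_lt_total m m') => [mm|e|mm]; first by rewrite mm in mm'.
    by rewrite e lm' in lm.
  by rewrite (lex_lt_trans lm' mm) in lm.
case: (lex_lt_total l m) => [lm|lm|ml].
- exists (m :: f1), f2; split=> //; last first.
    by move=> m'; rewrite inE => /orP[/eqP->|/H1].
  rewrite /= {1}fE; case: (m =P l) lm => [->|_ _]; last by rewrite add0n.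
  by rewrite lex_ltxx.
- subst m; have e := f1_0 (lex_ltxx l); exists [::], f2; split => //.
  by rewrite /= eqxx {1}fE e.
have lm : lex_lt l m = false.
  by apply/negP => /lex_lt_trans/(_ ml); rewrite lex_ltxx.
have nl : l \notin f.
  by apply/negP => /mf; rewrite lex_geE ml.
exists [::], (m :: f); split => //.
  rewrite /= (count_memPn nl) addn0; case: (m =P l) ml => [->|//].
  by rewrite lex_ltxx.
move=> m'; rewrite inE => /orP[/eqP->//|/mf].
rewrite lex_geE; case: (lex_lt_total m m') => [->//|<- //|mm _].
exact: lex_lt_trans mm ml.
Qed.

Lemma lex_min f : f <> [::] ->
  exists2 l, l \in f & forall m, m \in f -> m = l \/ lex_lt l m.
Proof.
elim: f => // u [|w f] IH _.
  by exists u; [rewrite mem_head|move=> v; rewrite inE => /eqP; left].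
have [//|m mf mmin] := IH.
case: (lex_lt_total m u) => [mu|e|um].
- exists m; first by rewrite inE mf orbT.
  by move=> v; rewrite inE => /orP[/eqP->|/mmin//]; right.
- exists m; first by rewrite inE mf orbT.
  by move=> v; rewrite inE => /orP[/eqP->|/mmin//]; left.
exists u; first by rewrite mem_head.
move=> v; rewrite inE => /orP[/eqP->|/mmin[->|mv]]; [by left|by right|].
by right; apply: lex_lt_trans um mv.
Qed.

Lemma dom_cat2r u v w : size u = size v -> dom (u ++ w) (v ++ w) = dom u v.
Proof.
elim: u v => [|x u IH] [|y v] //= => [_|[/IH ->//]].
exact: domxx.
Qed.

Lemma seq_max (S : eqType) (s : seq S) (F : S -> nat) : s <> [::] ->
  exists2 x, x \in s & forall y, y \in s -> (F y <= F x)%N.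
Proof.
elim: s => // x [|y s] IH _.
  by exists x; [rewrite mem_head|move=> y; rewrite inE => /eqP ->].
have [//|m ms mmax] := IH; case: (leqP (F m) (F x)) => le.
  exists x; first by rewrite mem_head.
  by move=> z; rewrite inE => /orP[/eqP->//|/mmax zm]; apply: leq_trans zm le.
exists m; first by rewrite inE ms orbT.
by move=> z; rewrite inE => /orP[/eqP->|/mmax//]; apply: ltnW.
Qed.

Lemma flatten_nseq l n : flatten (nseq n l) = wpow l n. Proof. by []. Qed.

End SortedFactors.

(** * Descent to smaller degree by contracting the coproduct *)

Section Independence.
Variables (k : fieldType) (d : Order.disp_t) (X : finOrderType d).

Local Notation VV := 'VV[k, X].
Local Notation T := 'T[k, X].
Local Notation TT := 'TT[k, X].
Local Notation mon := (@mon k d X).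
Implicit Types (u v w l m : seq X) (a p q r : T).

Variable c : VV -> VV.
Variable gamma : X -> X -> k.
Hypothesis c_tri : forall x y,
  supp (fun zt => (y < zt.1)%O) (c << (x, y) >> - gamma x y *: << (y, x) >>).
Hypothesis gamma_neq0 : forall x y, gamma x y != 0.
Variable I : properIdeal T.
Hypothesis cop_ideal : forall a, ideal_set I a ->
  set_add (tens_sub I setT) (tens_sub setT I) (cop c a).

Variable b : seq X -> T.
Hypothesis b_lead : forall l, lyndon l -> lead (@perm_eq X) l (b l).
Hypothesis b_dcop : forall l, lyndon l -> suppTT (tail_dom l) (dcop c (b l)).

Local Notation cop := (cop c).
Local Notation lead := (lead (@perm_eq X)).
Local Notation irreducible := (irreducible I).

(** The height condition of [B_I] in terms of powers, as [lt_heightP] shows. *)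
Definition pbw_word u : Prop := forall l, l \in lyndon_dec u ->
  irreducible (wpow l (count_mem l (lyndon_dec u))).

Definition pbw_elt u : T := lyndon_prod b (lyndon_dec u).

Local Notation pbw_map := (lext (fun w : {fmonom X} => pbw_elt w)).

Lemma pbw_elt_lead u : lead u (pbw_elt u).
Proof.
have [e ld _] := lyndon_dec_spec u.
by have := lyndon_prod_lead b_lead ld; rewrite e.
Qed.

(** Equal factors are adjacent in the nonincreasing decomposition, so the power in question is a
    factor of [u]. *)
Lemma irreducible_pbw u : irreducible u -> pbw_word u.
Proof.
move=> irr l _; have [e _ sd] := lyndon_dec_spec u.
have [f1 [f2 [fE _ _]]] := sorted_split l sd.
apply: (@irreducible_sub _ _ _ _ (flatten f1) _ (flatten f2)).
by rewrite -flatten_nseq -!flatten_cat -fE e.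
Qed.

Lemma contract_supp (g : seq X -> k) u (P : seq X -> seq X -> Prop)
    (Q : seq X -> Prop) (z : TT) :
  (forall w, std_gt w u -> g w = 0) -> suppTT P z ->
  (forall x y, P x y -> ~~ std_gt x u -> Q y) -> suppT Q (contract g z).
Proof.
move=> g0 Pz PQ; apply: suppT_lext Pz _ => -[x y] /= Pxy.
case: (boolP (std_gt x u)) => xu; first by rewrite g0 // scale0r; apply: supp0.
by apply: suppTZ; apply: suppT_mon; apply: PQ Pxy xu.
Qed.

Lemma cop_supp n a : suppT (fun w => size w < n)%N a ->
  suppTT (fun x y => size x + size y < n)%N (cop a).
Proof.
move=> sa; rewrite (linear_lext (cop : {linear T -> TT})).
apply: suppTT_lext sa _ => w wn; rewrite mon_val.
have top := @cop_top _ _ _ c gamma c_tri w.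
apply: (suppTT_subl (b := tensl (mon w))).
  by apply: suppTT_sub top => x y [-> _].
by rewrite /tensl lext_monT; apply: suppTT_mon2; rewrite addn0.
Qed.

Lemma lext_delta (q : T) (w1 : {fmonom X}) a :
  lext (fun w : {fmonom X} => (w == w1)%:R *: a) q = q@_w1 *: a.
Proof.
rewrite lext.unlock /lin; case: (boolP (w1 \in msupp q)) => w1q.
  rewrite (bigD1_seq w1) ?fset_uniq //= eqxx scale1r big1 ?addr0 // => w /negPf ->.
  by rewrite scale0r scaler0.
rewrite big_seq big1 ?(mcoeff_outdom w1q) ?scale0r // => w wq.
by case: (w =P w1) wq w1q => [-> ->//|_ _ _]; rewrite scale0r scaler0.
Qed.

Lemma lyndon_prod_cat_nseq f l n :
  lyndon_prod b (f ++ nseq n l) = lyndon_prod b f * b l ^+ n.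
Proof.
rewrite /lyndon_prod big_cat /=; congr (_ * _).
by elim: n => [|n IH]; rewrite ?big_nil // big_cons IH exprS.
Qed.

Section Step.
Variable N : nat.
Hypothesis IH : forall u, (size u < N)%N -> pbw_word u -> irreducible u.

(** Contracting with [g] produces an element of [I] with leading word [y1], a PBW word shorter than
    [N], hence irreducible by [IH]: a contradiction. *)
Lemma pbw_step q r : suppT (fun w => size w = N /\ pbw_word w) q ->
  suppT (fun w => size w < N)%N r -> ideal_set I (pbw_map q + r) -> q = 0.
Proof.
move=> sq sr Iqr; apply: contrapT => /eqP; rewrite -msupp_eq0 => /fset0Pn[w' w'q].
pose dec (w : {fmonom X}) := lyndon_dec w.
have dec_spec (w : {fmonom X}) := lyndon_dec_spec w.
(* In degree 0 the element is a nonzero scalar, which a proper ideal cannot contain. *)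
case: (posnP N) => [N0|N_gt0].
  have wE (w : {fmonom X}) : w \in msupp q -> w = FMonom [::].
    by move=> /sq[/eqP]; rewrite N0 size_eq0 => /eqP e _; rewrite -(fmonomK w) e.
  have r0 : r = 0 by apply: supp_mcoeff0 sr _ => w; rewrite N0.
  have qE : q = q@_w' *: 1.
    apply/malgP => w; rewrite mcoeffZ -mon0 /Defs.mon mcoeffU -(wE _ w'q).
    case: (w' =P w) => [->|ne]; first by rewrite mulr1.
    rewrite mulr0; apply: mcoeff_outdom; apply/negP => /wE e.
    by apply: ne; rewrite e (wE _ w'q).
  apply: (@ideal1 _ _ _ I); move: Iqr; rewrite r0 addr0 {1}qE linearZ /=.
  rewrite -[X in _ *: _ X]mon0 lext_monT /= /pbw_elt (@lyndon_dec_eq _ _ [::]) //.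
  rewrite /lyndon_prod big_nil => /(idealZ (q@_w')^-1).
  by rewrite scalerA mulVf ?mcoeff_neq0 // scale1r.
pose L := flatten [seq dec w | w : {fmonom X} <- msupp q].
have inL (w : {fmonom X}) m : w \in msupp q -> m \in dec w -> m \in L.
  by move=> wq mw; apply/flatten_mapP; exists w.
have L0 : L <> [::].
  case e : (dec w') => [|m s].
    have [e' _ _] := dec_spec w'; have [sz _] := sq _ w'q.
    by move: sz N_gt0; rewrite /= -e' -/(dec w') e => <-.
  have := inL w' m w'q; rewrite e mem_head => /(_ isT) mL e'.
  by rewrite e' in mL.
(* [l] is the smallest Lyndon factor in [q], [e] its highest multiplicity, and
   [y1] the leading cofactor of [wpow l e]. *)
have [l lL lmin] := lex_min L0.
have [wl wlq lwl] := flatten_mapP lL.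
have lyl : lyndon l by have [_ /allP lf _] := dec_spec wl; apply: lf.
have l_gt0 : (0 < size l)%N by have := lyndon_neq0 lyl; case: (l).
pose cnt (w : {fmonom X}) := count_mem l (dec w).
pose F (w : {fmonom X}) := [seq m <- dec w | m != l].
have Fl (w : {fmonom X}) m : w \in msupp q -> m \in F w -> lex_lt l m.
  move=> wq; rewrite mem_filter => /andP[ml mw].
  by case: (lmin m (inL _ _ wq mw)) => // e; rewrite e eqxx in ml.
(* Since no factor is smaller than [l], the copies of [l] form the end of the decomposition. *)
have decE (w : {fmonom X}) : w \in msupp q -> dec w = F w ++ nseq (cnt w) l.
  move=> wq; have [_ _ sd] := dec_spec w.
  have [f1 [f2 [fE H1 H2]]] := sorted_split l sd.
  have f2_0 : f2 = [::].
    case: f2 fE H2 => // m f2 fE H2; have ml := H2 m (mem_head _ _).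
    have : m \in dec w by rewrite /dec fE !mem_cat mem_head !orbT.
    move=> /(inL _ _ wq)/lmin[e|lm]; first by rewrite e lex_ltxx in ml.
    by have := lex_lt_trans lm ml; rewrite lex_ltxx.
  rewrite f2_0 cats0 in fE; rewrite /F {2}/dec fE filter_cat.
  rewrite (_ : [seq m <- nseq _ l | m != l] = [::]); last first.
    by apply/eqP; rewrite -size_eq0 size_filter -leqn0 leqNgt -has_count has_nseq eqxx andbF.
  rewrite cats0 (_ : [seq m <- f1 | m != l] = f1) //.
  apply/all_filterP/allP => m /H1 lm; apply/eqP => e.
  by rewrite e lex_ltxx in lm.
have lyF (w : {fmonom X}) : all (@lyndon _ X) (F w).
  have [_ /allP lf _] := dec_spec w; apply/allP => m.
  by rewrite mem_filter => /andP[_]; apply: lf.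
have szE (w : {fmonom X}) : w \in msupp q ->
    (size (flatten (F w)) + cnt w * size l)%N = N.
  move=> wq; have [<- _] := sq _ wq; have [E _ _] := dec_spec w.
  by rewrite -[in RHS]E -/(dec w) decE // flatten_cat size_cat flatten_nseq size_wpow.
have [|w0 w0q cntmax] := @seq_max _ (msupp q) cnt.
  by move=> E; have : w' \in enum_fset (msupp q) by []; rewrite E.
set e := cnt w0 in cntmax.
have e_gt0 : (0 < e)%N.
  by apply: leq_trans (cntmax wl wlq); rewrite -has_count has_pred1.
have irrle : irreducible (wpow l e).
  have [_ pw] := sq _ w0q; apply: pw.
  by rewrite -has_pred1 has_count.
have [g [g1 gstd gI]] := functional irrle.
have [|u1 u1Y u1min] := @std_min _ _ [seq (w : seq X) | w : {fmonom X} <- msupp q & cnt w == e].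
  move=> E; have : (w0 : seq X) \in [seq (w : seq X) | w : {fmonom X} <- msupp q & cnt w == e].
    by apply: (map_f (fun w : {fmonom X} => w : seq X)); rewrite mem_filter eqxx.
  by rewrite E.
have [w1 + u1E] := mapP u1Y; rewrite mem_filter => /andP[/eqP w1e w1q].
pose y1 := flatten (F w1).
have szy : (size y1 + e * size l = N)%N by rewrite -w1e szE.
pose C := gam gamma y1 (wpow l e).
have pbwE (w : {fmonom X}) : w \in msupp q ->
    pbw_elt w = lyndon_prod b (F w) * b l ^+ cnt w.
  by move=> wq; rewrite /pbw_elt -/(dec w) decE // lyndon_prod_cat_nseq.
(* If [w] has fewer than [e] copies of [l], only words shorter than [y1] survive. If it has [e]
   copies, the cofactor of [wpow l e] survives as well, and it dominates [y1] unless [w] is [w1]. *)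
have key (w : {fmonom X}) : w \in msupp q -> suppT (fun v => std_gt v y1)
    (contract g (cop (pbw_elt w)) - (w == w1)%:R *: (C *: mon y1)).
  move=> wq; rewrite pbwE //.
  set p := lyndon_prod b (F w); set Cw := gam gamma (flatten (F w)) (wpow l e) *+ (cnt w == e).
  have cl := cop_lyndon_power c_tri b_lead b_dcop lyl (lyF w)
    (fun m => @Fl w m wq) (cntmax w wq).
  rewrite /= szE // -/p -/Cw in cl.
  have lp : lead (flatten (F w)) p := lyndon_prod_lead b_lead (lyF w).
  have -> : contract g (cop (p * b l ^+ cnt w)) =
      contract g (cop (p * b l ^+ cnt w) - Cw *: tens (mon (wpow l e)) p) + Cw *: p.
    rewrite linearB linearZ /= contract_tens lext_monT /=.
    by rewrite g1 scale1r subrK.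
  rewrite -addrA; apply: suppTD.
    apply: (contract_supp gstd cl) => x y [xy dx].
    rewrite !std_gtE negb_or => /andP[xl xl'].
    (* [g] kills shorter left factors and those of equal length dominating [wpow l e]. The surviving
       left factors are longer, so the right factor is shorter than [y1]. *)
    have szx : (e * size l < size x)%N.
      rewrite size_wpow in xl xl'; case: (ltngtP (size x) (e * size l)%N) xl xl' dx => //= E _.
      by move=> /negPf dn /(_ E); rewrite dn.
    apply/orP; left.
    by rewrite -(ltn_add2l (size x)) xy -szy addnC ltn_add2r.
  case: (w =P w1) => [ww|ww].
    rewrite scale1r /Cw ww w1e eqxx mulr1n -/C -scalerBr; apply: suppTZ.
    move: lp; rewrite /p ww => lp; apply: lead_sub lp _ => v vy dv.
    by apply: std_gt_dom => //; apply: perm_size.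
  rewrite scale0r subr0 /Cw; case: (cnt w =P e) => [we|_]; last first.
    by rewrite mulr0n scale0r; apply: supp0.
  apply: suppTZ; apply: suppT_sub (lead_perm_supp lp) => v [vw dv].
  have szyw : size (flatten (F w)) = size y1
    by apply/eqP; rewrite -(eqn_add2r (e * size l)) szy -we szE.
  have [|uw|uw] := u1min w.
  - by apply: (map_f (fun w : {fmonom X} => w : seq X)); rewrite mem_filter we eqxx.
  - by case: ww; rewrite -(fmonomK w) uw u1E fmonomK.
  apply: std_gt_dom; first by rewrite (perm_size vw).
  (* [w] and [w1] have equal length and both end in [wpow l e], so their comparison is that of the
     cofactors. *)
  suff dyw : dom y1 (flatten (F w)) by apply: dom_step dyw dv.
  move: uw; rewrite std_gtE u1E.
  have [_ pw] := sq _ w1q; have [sw _] := sq _ wq; have [sw1 _] := sq _ w1q.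
  rewrite sw sw1 ltnn eqxx /=.
  have [E _ _] := dec_spec w; have [E1 _ _] := dec_spec w1.
  rewrite -E -E1 -/(dec w) -/(dec w1) !decE // !flatten_cat we w1e.
  by rewrite dom_cat2r.
have Z_ideal : ideal_set I (contract g (cop (pbw_map q + r))).
  by apply: contract_ideal gI _; apply: cop_ideal.
pose e1 := q@_w1 * C.
have e1_0 : e1 != 0 by rewrite mulf_neq0 ?mcoeff_neq0 // gam_neq0.
have sZ : suppT (fun v => std_gt v y1)
    (contract g (cop (pbw_map q + r)) - e1 *: mon y1).
  rewrite linearD linearD /= addrAC; apply: suppTD; last first.
    apply: (contract_supp gstd (cop_supp sr)) => x y xy.
    rewrite !std_gtE size_wpow negb_or -leqNgt => /andP[xl _].
    apply/orP; left.
    by rewrite -(ltn_add2l (size x)); apply: leq_trans xy _; rewrite -szy addnC leq_add2r.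
  rewrite -scalerA -lext_delta linear_lextE linear_lextE -lext_oppf -lext_addf.
  have sq' : supp (fun w : {fmonom X} => w \in msupp q) q by [].
  by apply: suppT_lext sq' _ => w /key.
have y1_lt : (size y1 < N)%N by rewrite -szy -{1}[size y1]addn0 ltn_add2l muln_gt0 e_gt0.
(* The contracted element expresses [y1] modulo [I] by larger words. What remains is to check that
   [y1] is a PBW word. *)
suff : irreducible y1.
  apply; apply/higherP; exists (- e1^-1 *: (contract g (cop (pbw_map q + r)) - e1 *: mon y1)).
    exact: suppTZ.
  rewrite scaleNr opprK scalerBr scalerA mulVf // scale1r addrC subrK.
  exact: idealZ.
apply: IH => // m; have [_ ld sd] := dec_spec w1.
have -> : lyndon_dec y1 = F w1.
  by apply: lyndon_dec_eq => //; apply: sorted_filter => //; apply: lex_ge_trans.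
move=> mF; have [_ pw] := sq _ w1q.
have ml : m != l by apply/eqP => ml; have := Fl w1 m w1q mF; rewrite ml lex_ltxx.
have -> : count_mem m (F w1) = count_mem m (dec w1).
  rewrite /F count_filter; apply: eq_count => m' /=.
  by case: (m' =P m) => // ->; rewrite ml.
by apply: pw; move: mF; rewrite mem_filter => /andP[].
Qed.

End Step.

(** Terms of lower degree stay in an unspecified remainder [r], because [pbw_step] allows one. *)
Definition reduces w a q : Prop :=
  suppT (fun v => [/\ size v = size w, pbw_word v & dom w v]) q /\
  exists2 r, suppT (fun v => size v < size w)%N r &
    ideal_set I (a - pbw_map q - r).

Lemma reduces_lin w e a p a' p' : reduces w a p -> reduces w a' p' ->
  reduces w (e *: a + a') (e *: p + p').
Proof.
move=> [sp [r sr Ir]] [sp' [r' sr' Ir']]; split.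
  by apply: suppTD => //; apply: suppTZ.
exists (e *: r + r'); first by apply: suppTD => //; apply: suppTZ.
rewrite linearP /=.
have -> : e *: a + a' - (e *: pbw_map p + pbw_map p') - (e *: r + r') =
    e *: (a - pbw_map p - r) + (a' - pbw_map p' - r').
  by apply/malgP => z; rewrite !(mcoeffB, mcoeffD, mcoeffZ); ring.
by apply: ideal_setD => //; apply: idealZ.
Qed.

Lemma reduces0 w : reduces w 0 0.
Proof.
split; first exact: supp0; exists 0; first exact: supp0.
by rewrite (raddf0 (lext _)) !subr0; apply: ideal_set0.
Qed.

(** Not the negation of [irreducible], but an expansion into PBW elements up to lower degree, which
    every word turns out to have. The last clause ensures that a PBW word occurs in its own
    expansion. *)
Definition reducible w : Prop := exists q r,
  [/\ suppT (fun v => [/\ size v = size w, pbw_word v & v = w \/ dom w v]) q,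
      suppT (fun v => size v < size w)%N r,
      ideal_set I (mon w - pbw_map q - r) &
      pbw_word w -> q@_(FMonom w) = 1].

Lemma reduces_mon w v : reducible v -> std_gt v w ->
  exists q, reduces w (mon v) q.
Proof.
move=> [q [r [sq sr Iqr _]]].
rewrite std_gtE => /orP[vlt|/andP[/eqP szv wv]].
  exists 0; split; first exact: supp0.
  exists (mon v); first exact: suppT_mon.
  by rewrite (raddf0 (lext _)) subr0 subrr; apply: ideal_set0.
exists q; split; last by exists r => //; apply: suppT_sub sr => t; rewrite szv.
apply: suppT_sub sq => t [st pt tv]; split => //; first by rewrite st.
exact: dom_step tv.
Qed.

(** A PBW word is traded for its PBW element. Any other word is not irreducible and is replaced
    modulo [I]. In both cases only larger words remain to be expanded. *)
Lemma all_reducible w : reducible w.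
Proof.
elim/std_ind: w => w IH.
have step (v : {fmonom X}) : std_gt v w -> exists q, reduces w << v >> q.
  by move=> vw; rewrite mon_val; apply: reduces_mon (IH v vw) vw.
have lift a : suppT (fun v => std_gt v w) a -> exists q, reduces w a q :=
  @basis_lift _ _ _ _ _ a (reduces0 w) (@reduces_lin w) step.
case: (pselect (pbw_word w)) => pw.
  have [|q [sq [r sr Iqr]]] := lift (pbw_elt w - mon w).
    by apply: lead_sub (@pbw_elt_lead w) _ => v /perm_size vw wv; apply: std_gt_dom.
  exists (mon w - q), (- r); split.
  - apply: suppTB; first by apply: suppT_mon; split => //; left.
    by apply: suppT_sub sq => v [? ? ?]; split => //; right.
  - exact: suppN.
  - rewrite linearB /= lext_monT /=.
    have -> : mon w - (pbw_elt w - pbw_map q) - - r =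
        - (pbw_elt w - mon w - pbw_map q - r).
      by rewrite !opprD !opprK [mon w + _]addrCA addrA.
    exact: idealN.
  move=> _; rewrite mcoeffB mcoeffUU (_ : q@__ = 0) ?subr0 //.
  by apply: mcoeff_outdom; apply/negP => /sq[_ _]; rewrite domxx.
have /higherP[s ss Is] : higher I w (mon w).
  by apply: contrapT => irr; apply: pw; apply: irreducible_pbw.
have [q [sq [r sr Iqr]]] := lift _ ss; exists q, r; split => //.
  by apply: suppT_sub sq => v [? ? ?]; split => //; right.
have -> : mon w - pbw_map q - r = (mon w - s) + (s - pbw_map q - r).
  by rewrite !addrA subrK.
exact: ideal_setD.
Qed.

(** If [u] were congruent to a combination [s] of larger words, [pbw_step] would identify the
    expansions of [u] and [s]; but [u] has coefficient 1 in the first and 0 in the second. *)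
Lemma pbw_irreducible u : pbw_word u -> irreducible u.
Proof.
have [n] := ubnP (size u); elim: n u => // n IH u un pu /higherP[s ss Is].
have [q [r [sq sr Iqr /(_ pu) qu]]] := all_reducible u.
have step (v : {fmonom X}) : std_gt v u -> exists q, reduces u << v >> q.
  by rewrite mon_val; apply: reduces_mon (all_reducible v).
have [q' [sq' [r' sr' Iqr']]] :=
  @basis_lift _ _ _ _ _ s (reduces0 u) (@reduces_lin u) step ss.
have /eqP : q - q' = 0.
  apply: (@pbw_step (size u) _ (q - q') (r - r')).
  - by move=> v vu; apply: IH; apply: leq_trans vu _.
  - apply: suppTB; first by apply: suppT_sub sq => v [].
    by apply: suppT_sub sq' => v [].
  - exact: suppTB.
  have -> : pbw_map (q - q') + (r - r') =
      (mon u - s) - (mon u - pbw_map q - r) + (s - pbw_map q' - r').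
    rewrite linearB /=; apply/malgP => z.
    by rewrite !(mcoeffB, mcoeffD); ring.
  by apply: ideal_setD => //; apply: idealB.
rewrite subr_eq0 => /eqP qq; have := oner_neq0 k.
rewrite -qu qq mcoeff_outdom ?eqxx //.
by apply/negP => /sq'[_ _]; rewrite domxx.
Qed.

End Independence.

(** * Commutators and PBW sets *)

Section Triangularity.
Variables (k : fieldType) (d : Order.disp_t) (X : finOrderType d).
Local Notation VV := 'VV[k, X].
Variable c : {linear VV -> VV}.
Hypothesis c_inj : injective c.
Variable gamma : X -> X -> k.
Hypothesis c_tri : forall x y,
  supp (fun zt => (y < zt.1)%O) (c << (x, y) >> - gamma x y *: << (y, x) >>).

(* [c] maps [V (x) V_{>= y}] into [V_{>= y} (x) V]; by injectivity these maps
   are onto, which forces the diagonal entries not to vanish. *)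
Lemma gamma_neq0 x y : gamma x y != 0.
Proof.
pose onto y := forall x, exists a,
  supp (fun zt : X * X => (y <= zt.2)%O) a /\ c a = << (y, x) >>.
suff H : (forall x, gamma x y != 0) /\ onto y by case: H.
(* Downward induction on [y], by the number of letters above it. *)
have [n] := ubnP #|[pred z : X | (y < z)%O]|; elim: n x y => // n IH _ y yn.
have above z : (y < z)%O -> onto z.
  move=> yz; have [|//] := IH z z; move: yn; rewrite ltnS; apply: leq_trans.
  apply: proper_card; apply/properP; split.
    by apply/fintype.subsetP => t; rewrite !inE; apply: lt_trans.
  by exists z; rewrite !inE ?ltxx.
have lift b : supp (fun zt : X * X => (y < zt.1)%O) b ->
    exists a, supp (fun zt : X * X => (y < zt.2)%O) a /\ c a = b.
  move=> sb.
  have H zt : (y < zt.1)%O -> exists a,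
      supp (fun zt : X * X => (y < zt.2)%O) a /\ c a = << zt >>.
    case: zt => z t /= yz; have [a [sa ca]] := above z yz t; exists a; split => //.
    by apply: supp_sub sa => w; apply: lt_le_trans.
  pose R (b a : VV) := supp (fun zt : X * X => (y < zt.2)%O) a /\ c a = b.
  apply: (@basis_lift _ _ _ R _ b _ _ H sb) => [|e b1 a1 b2 a2 [s1 <-] [s2 <-]].
    by split; [apply: supp0|rewrite raddf0].
  by split; [apply: suppD => //; apply: suppZ|rewrite linearP].
(* If it vanished, [c] would send [x (x) y] to pairs with first letter above [y]. These have
   preimages with second letter above [y], against injectivity. *)
have nz x : gamma x y != 0.
  apply/eqP => g0; have := @c_tri x y; rewrite g0 scale0r subr0 => /lift[a [sa ca]].
  have axy := c_inj ca; have /suppP/(_ (x, y)) := sa.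
  rewrite axy mcoeffUU ltxx => /(_ _)/eqP; rewrite oner_eq0 => H.
  by have := H (fun h => notF h).
split=> // x; have [a [sa ca]] := lift _ (@c_tri x y).
(* The triangular formula solved for [y (x) x], with [a] the preimage of the remainder. *)
exists ((gamma x y)^-1 *: (<< (x, y) >> - a)); split.
  apply: suppZ; apply: suppB; first exact: supp_mon.
  by apply: supp_sub sa => w; apply: ltW.
rewrite linearZ linearB /= ca opprB addrC subrK scalerA mulVf // scale1r.
by [].
Qed.

End Triangularity.

Lemma left_triangularP (k : fieldType) (d : Order.disp_t) (X : finOrderType d)
    (c : 'VV[k, X] -> 'VV[k, X]) : left_triangular c ->
  exists gamma : X -> X -> k, forall x y,
    supp (fun zt => (y < zt.1)%O) (c << (x, y) >> - gamma x y *: << (y, x) >>).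
Proof.
move=> [gamma [v cE]]; exists gamma => x y; rewrite cE addrAC subrr add0r.
elim/big_ind: _ => [|a b|z yz]; [exact: supp0|exact: suppD|].
rewrite /tens lextE lext_mon lextE.
by apply: (@supp_lext _ _ _ (fun _ => True)) => // t _; apply: supp_mon.
Qed.

(** * Leading words of the braided commutators *)

Section Bracket.
Variables (k : fieldType) (d : Order.disp_t) (X : finOrderType d).

Local Notation VV := 'VV[k, X].
Local Notation T := 'T[k, X].
Local Notation mon := (@mon k d X).
Implicit Types (u v w l m : seq X) (a p q r : T).

Variable c : VV -> VV.
Variable gamma : X -> X -> k.
Hypothesis c_tri : forall x y,
  supp (fun zt => (y < zt.1)%O) (c << (x, y) >> - gamma x y *: << (y, x) >>).

(** The braiding [c] may replace letters by others, so commutators are homogeneous in length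
    only. *)
Definition same_size : rel (seq X) := fun w u => size w == size u.

Lemma same_size_cat u u' v v' : same_size u u' -> same_size v v' ->
  same_size (u ++ v) (u' ++ v').
Proof. by rewrite /same_size !size_cat => /eqP-> /eqP->. Qed.

Lemma mulT_tens a p : mulT (tens a p) = a * p.
Proof.
rewrite /mulT lextE tensE lext_lext mulTE; apply: eq_lext => u _.
rewrite lext_lext; apply: eq_lext => v _.
by rewrite lext_mon2 /= monM.
Qed.

Lemma mulT_tbraid_tens a p : mulT (tbraid c (tens a p)) =
  lext (fun u : {fmonom X} => lext (fun v : {fmonom X} =>
    lext (fun z => mon (z.1 ++ z.2)) (braid_word c u v)) p) a.
Proof.
rewrite /mulT lextE {1}/tbraid lextE tensE !lext_lext; apply: eq_lext => u _.
rewrite !lext_lext; apply: eq_lext => v _.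
rewrite lext_mon2 -[X in lext _ X]/(lin _ _) /= lextE braidE !lext_lext.
apply: eq_lext => z /braid_word_size[z1 _].
rewrite lext_monT /= (take_size_cat _ z1) (drop_size_cat _ z1) tens_mon.
by rewrite lext_mon2 /= monM.
Qed.

(** The words of the braided summand begin with a word at or above [w], and [w] dominates the Lyndon
    word [v ++ w]. *)
Lemma lyndon_bracket_lead n u : lyndon u -> (size u <= n)%N ->
  lead same_size u (lyndon_bracket c n u).
Proof.
elim: n u => [|n IH] u lu; first by rewrite leqn0 size_eq0 => /eqP u0; case/lyndonP: lu.
move=> un /=; case: leqP => u1; first by apply: lead_mon.
have [v [w [uE lv lw ->]]] := shirshov_spec lu u1.
have -> : take (size v) u = v by rewrite uE take_size_cat.
have -> : drop (size v) u = w by rewrite uE drop_size_cat.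
have v0 := lyndon_neq0 lv; have w0 := lyndon_neq0 lw.
have sv : (0 < size v)%N by case: (v) v0.
have sw : (0 < size w)%N by case: (w) w0.
have suE : size u = (size v + size w)%N by rewrite uE size_cat.
have lead_v : lead same_size v (lyndon_bracket c n v) by apply: IH => //; lia.
have lead_w : lead same_size w (lyndon_bracket c n w) by apply: IH => //; lia.
have refl : reflexive same_size by move=> t; apply: eqxx.
have dvw : dom (v ++ w) w by apply: lyndon_cat_dom => //; rewrite -uE.
have -> : mulT (tens (lyndon_bracket c n v) (lyndon_bracket c n w) -
     tbraid c (tens (lyndon_bracket c n v) (lyndon_bracket c n w))) =
    lyndon_bracket c n v * lyndon_bracket c n w -
    mulT (tbraid c (tens (lyndon_bracket c n v) (lyndon_bracket c n w))).
  by rewrite -mulT_tens /mulT !lextE linearB.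
rewrite uE /lead addrAC; apply: suppTB.
  exact: (lead_mul refl same_size_cat lead_v lead_w).
rewrite mulT_tbraid_tens.
apply: suppT_lext (lead_supp refl lead_v) _ => t [/eqP tv _].
apply: suppT_lext (lead_supp refl lead_w) _ => t' [/eqP tw wt].
apply: suppT_lext (@braid_word_supp _ _ _ _ _ c_tri t t') _ => z [z1 z2 z3].
apply: suppT_mon; split.
  by rewrite /same_size !size_cat z1 z2 tv tw addnC.
by apply: dom_catr; apply: dom_step z3; apply: dom_step wt.
Qed.

Lemma bracket_mon u : bracket c (mon u) =
  \prod_(l <- lyndon_dec u) lyndon_bracket c (size l) l.
Proof. by rewrite /bracket lextE lext_monT. Qed.

Lemma bracket_lead u : suppT (fun w => std_gt w u) (bracket c (mon u) - mon u).
Proof.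
have [e ld _] := lyndon_dec_spec u; rewrite bracket_mon.
have refl : reflexive same_size by move=> t; apply: eqxx.
have := @lead_prod _ _ _ same_size refl same_size_cat
  (fun l => lyndon_bracket c (size l) l) (lyndon_dec u).
rewrite e => H; apply: lead_sub (H _) _.
  by move=> l /(allP ld) ll; apply: lyndon_bracket_lead.
by move=> w /eqP wu uw; apply: std_gt_dom.
Qed.

Lemma bracket_lyndon l : lyndon l ->
  bracket c (mon l) = lyndon_bracket c (size l) l.
Proof. by move=> ll; rewrite bracket_mon lyndon_dec1 // big_seq1. Qed.

End Bracket.

(** * PBW sets and irreducible words *)

Section PBWSet.
Variables (k : fieldType) (d : Order.disp_t) (X : finOrderType d).
Local Notation T := 'T[k, X].
Local Notation mon := (@mon k d X).
Implicit Types (u v w l m : seq X).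
Variable I : properIdeal T.
Local Notation irreducible := (irreducible I).

(** A smaller power is a factor of a larger one, so the exponents with irreducible power are exactly
    those below the minimum taken in [h_]. *)
Lemma lt_heightP l e : lt_height e (h_ I l) <-> irreducible (wpow l e).
Proof.
rewrite /h_; case: pselect => [ex|nex] /=; last first.
  by split=> // _ hi; apply: nex; exists e; apply/asboolP.
case: ex_minnP => n /asboolP hn nmin; split=> [en hi|irr].
  by have := nmin e; rewrite leqNgt en => /(_ (asboolT hi)).
rewrite ltnNge; apply/negP => ne.
suff : irreducible (wpow l n) by apply.
apply: (@irreducible_sub _ _ _ _ [::] _ (wpow l (e - n))).
by rewrite /= -wpowD subnKC.
Qed.

Lemma S_P l : S_ I l <-> lyndon l /\ irreducible l.
Proof. by []. Qed.

Definition expand (s : seq (seqlexi X * nat)) : seq (seq X) :=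
  flatten [seq nseq le.2 (le.1 : seq X) | le <- s].

Lemma prod_expand (A : nzRingType) (g : seq X -> A) s :
  \prod_(l <- expand s) g l = \prod_(le <- s) g le.1 ^+ le.2.
Proof.
elim: s => [|[l n] s IH]; first by rewrite !big_nil.
rewrite /expand /= big_cat big_cons -IH; congr (_ * _).
by elim: n => [|n IHn]; rewrite ?big_nil // big_cons IHn exprS.
Qed.

Lemma mem_expand s m : m \in expand s -> exists2 e, (m, e) \in s & (0 < e)%N.
Proof.
move=> /flatten_mapP[[l e] ls]; rewrite mem_nseq => /andP[e0 /eqP ->].
by exists e.
Qed.

Local Notation decreasing s :=
  (sorted (fun a b : seqlexi X => (b < a)%O) [seq le.1 | le <- s]).

Lemma decreasing_cons (l : seqlexi X) e (s : seq (seqlexi X * nat)) :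
  decreasing ((l, e) :: s) =
  all (fun m : seqlexi X => (m < l)%O) [seq le.1 | le <- s] && decreasing s.
Proof.
rewrite /= path_sortedE // => a b b' ab ba'.
exact: lt_trans ba' ab.
Qed.

Lemma expand_sorted s : decreasing s -> sorted (@lex_ge _ X) (expand s).
Proof.
elim: s => [|[l e] s IH] //; rewrite decreasing_cons => /andP[/allP ls /IH ss].
rewrite /expand /=; elim: e => [|e IHe] //=.
rewrite path_sortedE; last exact: lex_ge_trans.
rewrite IHe andbT; apply/allP => m; rewrite mem_cat mem_nseq => /orP[/andP[_ /eqP ->]|].
  by rewrite lex_geE lex_ltxx.
by move=> /mem_expand[n /(map_f fst)/ls ml _]; apply: ltW.
Qed.

Lemma count_expand s l e : decreasing s -> (l, e) \in s ->
  count_mem l (expand s) = e.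
Proof.
elim: s => [|[m n] s IH] //; rewrite decreasing_cons => /andP[/allP ms ds].
rewrite /expand /= count_cat inE count_nseq => /orP[/eqP[-> ->]|ls].
  rewrite /= eqxx mul1n (count_memPn _) ?addn0 //.
  by apply/negP => /mem_expand[n' /(map_f fst)/ms]; rewrite ltxx.
have := ms _ (map_f fst ls) => /= lm.
apply: etrans (congr1 (addn _) (IH ds ls)) _.
by rewrite /= (gt_eqF lm) mul0n.
Qed.

Lemma sorted_expand f : sorted (@lex_ge _ X) f -> exists s, [/\ decreasing s,
  f = expand s & forall le, le \in s -> (0 < le.2)%N].
Proof.
elim: f => [|m f IH]; first by exists [::].
rewrite sorted_cons_ge => /andP[/allP mf /IH [[|[l n] s] [ds fE pos]]].
  by exists [:: (m, 1%N)]; split=> [//||le]; [rewrite fE|rewrite inE => /eqP ->].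
have n0 : (0 < n)%N by apply: (pos (l, n)); rewrite mem_head.
have ml : lex_ge m l.
  by apply: mf; rewrite fE /expand /= mem_cat mem_nseq n0 eqxx.
case: (m =P l) => [->|ne].
  exists ((l, n.+1) :: s); split=> [//||le].
    by rewrite fE.
  by rewrite inE => /orP[/eqP->//|les]; apply: pos; rewrite inE les orbT.
exists [:: (m, 1%N), (l, n) & s]; split=> [||le].
- rewrite decreasing_cons ds andbT; move: ds; rewrite decreasing_cons => /andP[/allP ls _].
  have lm : ((l : seqlexi X) < m)%O 
    by rewrite lt_neqAle; apply/andP; split=> //; apply/eqP => e; apply: ne.
  apply/allP => t; rewrite inE => /orP[/eqP->//|/ls tl].
  exact: lt_trans tl lm.
- by rewrite fE.
by rewrite inE => /orP[/eqP->//|les]; apply: pos.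
Qed.

Hypothesis pbw_irr : forall u, pbw_word I u -> irreducible u.

(** Decreasing generators with exponents below the heights are the Lyndon decompositions of PBW
    words, written with multiplicities. The map [g] is arbitrary, to cover words in the free algebra
    and both families in the quotient. *)
Lemma pbw_setE (A : lalgType k) (g : seq X -> A) :
  pbw_set (S_ I) (h_ I) g =
  [set \prod_(l <- lyndon_dec u) g l | u in irreducible].
Proof.
apply/seteqP; split=> [p [s [ds sP ->]]|p [u irr <-]].
  have lye : all (@lyndon _ X) (expand s).
    by apply/allP => l /mem_expand[e /sP[[] //]].
  exists (flatten (expand s)); last first.
    by rewrite lyndon_dec_eq ?expand_sorted // prod_expand.
  apply: pbw_irr => l; rewrite lyndon_dec_eq ?expand_sorted // => /mem_expand[e les _].
  by rewrite (count_expand ds les); apply/lt_heightP; have [] := sP _ les.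
have [e ld sd] := lyndon_dec_spec u; have [s [ds sE pos]] := sorted_expand sd.
exists s; split => //; last by rewrite sE prod_expand.
move=> [l n] ls; have n0 := pos _ ls; have ln : irreducible (wpow l n).
  have [s1 [s2 ss]] : exists s1 s2, s = s1 ++ (l, n) :: s2.
    by case/splitPr: ls => s1 s2; exists s1, s2.
  apply: (@irreducible_sub _ _ _ _ (flatten (expand s1)) _ (flatten (expand s2))).
  rewrite -flatten_nseq -!flatten_cat; move: irr; rewrite -e sE ss.
  by rewrite /expand map_cat flatten_cat /=.
split => //=; last exact/lt_heightP.
apply/S_P; split.
  apply: (allP ld); rewrite sE; apply/flatten_mapP; exists (l, n) => //.
  by rewrite mem_nseq n0 eqxx.
apply: (@irreducible_sub _ _ _ _ [::] _ (wpow l n.-1)).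
by rewrite /= -wpowS prednK.
Qed.

Lemma prod_mon f : \prod_(l <- f) mon l = mon (flatten f).
Proof.
elim: f => [|l f IH]; first by rewrite big_nil mon0.
by rewrite big_cons IH monM.
Qed.

Lemma B_E : B_ I = [set mon u | u in irreducible].
Proof.
rewrite /B_ pbw_setE; apply: eq_imagel => u _.
by rewrite prod_mon; have [-> _ _] := lyndon_dec_spec u.
Qed.

End PBWSet.

(** * Bases of the quotient algebra *)

Section QuotientBasis.
Variables (k : fieldType) (d : Order.disp_t) (X : finOrderType d).
Local Notation T := 'T[k, X].
Local Notation mon := (@mon k d X).
Implicit Types (u v : seq X).
Variable I : properIdeal T.
Local Notation irreducible := (irreducible I).
Local Notation pi := (@quotient_map T I).

Lemma quotient_map0 (a : T) : pi a = 0 <-> ideal_set I a.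
Proof.
rewrite -(raddf0 pi); split=> [/eqP|Ia].
  by rewrite quotient_map_eq subr0 => /asboolP.
by apply/eqP; rewrite quotient_map_eq subr0; apply/asboolP.
Qed.

Variable h : seq X -> T.
Hypothesis h_lead : forall u, irreducible u ->
  suppT (fun w => std_gt w u) (h u - mon u).

Lemma quotient_map_inj u v : irreducible u -> irreducible v ->
  pi (h u) = pi (h v) -> u = v.
Proof.
move=> iu iv uv; have : mon u - mon v = 0.
  apply: (irreducible_indep h_lead).
    by apply: suppTB; apply: suppT_mon.
  by apply/quotient_map0; rewrite linearB /= !lext_monT raddfB /= uv subrr.
move=> /(congr1 (mcoeff (FMonom u))); rewrite mcoeffB mcoeffUU mcoeff0 mcoeffU.
case: eqP => [[->] //|_] /eqP; by rewrite subr0 oner_eq0.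
Qed.

(** Both halves translate [irreducible_indep] and [irreducible_gen]. As [is_basis] attaches
    coefficients to vectors, a choice function [U] recovers an irreducible word from its image. *)
Lemma quotient_basis : is_basis (pi @` [set h u | u in irreducible]).
Proof.
have ex x : exists u, (exists2 v, irreducible v & pi (h v) = x) ->
    irreducible u /\ pi (h u) = x.
  case: (pselect (exists2 v, irreducible v & pi (h v) = x)) => [[v iv vx]|nex].
    by exists v.
  (* A default word for vectors outside the image. *)
  by exists [::].
have [U UP] := choice ex.
have imP x : (pi @` [set h u | u in irreducible]) x ->
    exists2 u, irreducible u & pi (h u) = x.
  by move=> [_ [u iu <-] <-]; exists u.
split.
  move=> s e us sP e0 x xs.
  have UE y : y \in s -> irreducible (U y) /\ pi (h (U y)) = y.
    by move=> /sP /imP /UP.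
  pose q := \sum_(y <- s) e y *: mon (U y).
  have : q = 0.
    apply: (irreducible_indep h_lead).
      apply: (@supp_sum _ _ (fun w : {fmonom X} => irreducible w)) => y /UE[iy _].
      by apply: suppZ; apply: suppT_mon.
    apply/quotient_map0; rewrite -[RHS]e0 /q !linear_sum.
    apply: eq_big_seq => y /UE[_ yE].
    by rewrite !linearZ /= lext_monT /= yE.
  move=> /(congr1 (mcoeff (FMonom (U x)))); rewrite mcoeff0 => <-.
  have cU y : (e y *: mon (U y))@_(FMonom (U x)) = e y * (U y == U x)%:R.
    by rewrite mcoeffZ mcoeffU.
  rewrite /q raddf_sum (bigD1_seq x xs us) /= big_seq_cond big1 => [|y /andP[ys yx]].
    by rewrite addr0; refine (esym (etrans (cU x) _)); rewrite eqxx mulr1.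
  refine (etrans (cU y) _); case: eqP => [E|_]; last by rewrite mulr0.
  by case/eqP: yx; rewrite -(UE y ys).2 -(UE x xs).2 E.
apply/seteqP; split => // y _; rewrite -[y]quotient_reprK.
move: (quotient_repr y) => p.
have [q [sq Iq]] : exists q, suppT irreducible q /\
    ideal_set I (p - lext (fun v : {fmonom X} => h v) q).
  pose R (a b : T) := suppT irreducible b /\
    ideal_set I (a - lext (fun v : {fmonom X} => h v) b).
  apply: (@basis_lift _ _ _ R (fun _ => True)) => //.
  - by split; [exact: supp0|rewrite (raddf0 (lext _)) subr0; apply: ideal_set0].
  - move=> e a b a' b' [sb Iab] [sb' Iab']; split.
      by apply: suppTD => //; apply: suppTZ.
    rewrite linearP /= opprD addrACA -scalerBr.
    by apply: ideal_setD => //; apply: idealZ.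
  move=> w _; rewrite mon_val; have [q [sq Iq]] := irreducible_gen h_lead w.
  by exists q; split => //; apply: suppT_sub sq => v [].
exists [seq pi (h (w : seq X)) | w : {fmonom X} <- msupp q],
  (fun x => q@_(FMonom (U x))).
split=> [x /mapP[w wq ->]|].
  by exists (h w) => //; exists (w : seq X) => //; apply: sq.
have -> : pi p = pi (lext (fun v : {fmonom X} => h v) q).
  by apply/eqP; rewrite quotient_map_eq; apply/asboolP.
rewrite linear_lextE lext.unlock big_map; apply: eq_big_seq => w wq.
have iw : irreducible w := sq _ wq.
have [iU UE] := UP (pi (h w)) (ex_intro2 _ _ _ iw erefl).
by rewrite (quotient_map_inj iU iw UE) fmonomK.
Qed.

End QuotientBasis.

(** Injectivity accompanies each clause because [is_basis] and [pbw_set] see only sets of images: it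
    makes distinct words give distinct basis vectors and lets the order and the heights be
    transported to the generators. *)
Theorem theorem35 (k : fieldType) (d : Order.disp_t) (X : finOrderType d)
    (c : {linear 'VV[k, X] -> 'VV[k, X]})
    (c_bij : bijective c) (c_braid : braid_eq c) (c_tri : left_triangular c)
    (I : properIdeal 'T[k, X]) (I_biideal : braided_biideal c I) :
  let pi : 'T[k, X] -> quotient I := @quotient_map 'T[k, X] I in
  let word : seqlexi X -> 'T[k, X] := @mon k d X in
  let comm : 'T[k, X] -> 'T[k, X] := bracket c in
  [/\ {in B_ I &, injective pi} /\ is_basis (pi @` B_ I),
      {in B_ I &, injective (pi \o comm)} /\ is_basis (pi @` (comm @` B_ I)),
      {in S_ I &, injective (pi \o word)}
        /\ pi @` B_ I = pbw_set (S_ I) (h_ I) (pi \o word) &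
      {in S_ I &, injective (pi \o comm \o word)}
        /\ pi @` (comm @` B_ I) = pbw_set (S_ I) (h_ I) (pi \o comm \o word)].
Proof.
move=> pi word comm.
have [gamma tri] := left_triangularP c_tri.
have gamma0 := gamma_neq0 (bij_inj c_bij) tri.
have [b bP] := choice (lyndon_elt tri gamma0).
have cop_ideal a : ideal_set I a ->
    set_add (tens_sub I setT) (tens_sub setT I) (cop c a).
  by move=> Ia; rewrite cop.unlock; case: I_biideal => + _ _; apply.
have pbw_irr := pbw_irreducible tri gamma0 cop_ideal
  (fun l ll => (bP l ll).1) (fun l ll => (bP l ll).2).
(* Words and commutators are two families with leading word [u], so the results on the quotient
   apply to both. *)
have mon_lead u : irreducible I u -> suppT (fun w => std_gt w u) (mon k u - mon k u).
  by move=> _; rewrite subrr; apply: supp0.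
have comm_lead u : irreducible I u ->
    suppT (fun w => std_gt w u) (comm (mon k u) - mon k u).
  by move=> _; apply: bracket_lead tri _.
have BE : B_ I = [set mon k u | u in irreducible I] := B_E pbw_irr.
have BP p : p \in B_ I -> exists2 u, irreducible I u & p = mon k u.
  by rewrite BE => /set_mem[u iu <-]; exists u.
have SP (u : seqlexi X) : u \in S_ I -> irreducible I u by move=> /set_mem[].
have commE : comm @` B_ I = [set comm (mon k u) | u in irreducible I].
  by rewrite BE image_comp.
split; split.
- by move=> _ _ /BP[u iu ->] /BP[v iv ->] /(quotient_map_inj mon_lead iu iv) ->.
- by rewrite BE; apply: (quotient_basis mon_lead).
- by move=> _ _ /BP[u iu ->] /BP[v iv ->] /(quotient_map_inj comm_lead iu iv) ->.
- by rewrite commE; apply: (quotient_basis comm_lead).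
- by move=> u v /SP iu /SP iv /(quotient_map_inj mon_lead iu iv).
- rewrite (pbw_setE pbw_irr) BE image_comp; apply: eq_imagel => u _ /=.
  by rewrite -rmorph_prod prod_mon; have [-> _ _] := lyndon_dec_spec u.
- by move=> u v /SP iu /SP iv /(quotient_map_inj comm_lead iu iv).
rewrite (pbw_setE pbw_irr) commE image_comp; apply: eq_imagel => u _ /=.
rewrite /pi /comm bracket_mon rmorph_prod; apply: eq_big_seq => l.
by have [_ /allP ld _] := lyndon_dec_spec u; move=> /ld ll; rewrite bracket_lyndon.
Qed.
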